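(* If $\frac{\ln n+\ln\ln n+\omega(1)}{n}\leq p\leq\frac{1.02\ln n}{n}$ and $G\sim G(n,p)$, then with high probability $r_\ell(G,\mathcal{HAM})=\delta(G)-1$.
   Context: $G(n,p)$ is the binomial random graph on vertex set $[n]$ in which each pair is an edge independently with probability $p$; ''with high probability'' means with probability tending to $1$ as $n\to\infty$; $\omega(1)$ denotes an arbitrary function of $n$ tending to infinity. $\mathcal{HAM}$ is the property of containing a Hamilton cycle, and $\delta(G)$ is the minimum degree of $G$. The local resilience of $G$ with respect to a monotone increasing property $\mathcal{P}$ is $r_\ell(G,\mathcal{P})=\min\{r:\exists H\subseteq G \text{ with } \Delta(H)=r \text{ and } G- H\notin\mathcal{P}\}$, where $G-H$ is the graph on the same vertex set with edge set $E(G)\setminus E(H)$ and $\Delta(H)$ is the maximum degree of $H$. *)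

(* Defs.v *)
From HB Require Import structures.
From mathcomp Require Import all_boot all_order all_algebra.
From mathcomp Require Import all_classical all_reals all_analysis.
Set Implicit Arguments.
Unset Strict Implicit.
Unset Printing Implicit Defensive.
Import Order.TTheory GRing.Theory Num.Theory.
Import numFieldNormedType.Exports.

(* Simple graphs on the vertex set 'I_n: arbitrary sets of 2-element subsets. *)
Definition edge (n : nat) : finType := {e : {set 'I_n} | #|e| == 2}.
Definition graph (n : nat) : finType := {set edge n}.

Definition adj (n : nat) (G : graph n) : rel 'I_n :=
  fun u v => [exists e in G, val e == [set u; v]%SET].

Definition degree (n : nat) (G : graph n) (v : 'I_n) : nat :=
  #|[set e in G | v \in val e]%SET|.

Definition max_degree (n : nat) (G : graph n) : nat :=
  \max_(v < n) degree G v.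

(* Degrees are less than n, so for n > 0 the default value n of the iterated  *)
(* minimum plays no role (see min_degreeP).                                   *)
Definition min_degree (n : nat) (G : graph n) : nat :=
  \big[minn/n]_(v < n) degree G v.

Definition hamiltonian (n : nat) (G : graph n) : bool :=
  (2 < n) && [exists c : n.-tuple 'I_n, uniq c && cycle (adj G) c].

(* The default value n matters only if no H qualifies, i.e., if P holds for   *)
(* all the subgraphs of G; this never happens for P = hamiltonian, which      *)
(* excludes the edgeless graph (see local_resilience_hamP).                   *)
Definition local_resilience (n : nat) (P : pred (graph n)) (G : graph n) : nat :=
  \big[minn/n]_(H : graph n | (H \subset G) && ~~ P (G :\: H)%SET) max_degree H.

(* Probability that G(n, p) has the property A: the pairs in edge n are       *)
(* present independently, each with probability p.                            *)
Definition Gnp_prob (n : nat) (R : realType) (p : R) (A : pred (graph n)) : R :=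
  (\sum_(G : graph n | A G) \prod_(e : edge n) (if e \in G then p else 1 - p))%R.

Lemma degree_ltn (n : nat) (G : graph n) (v : 'I_n) : degree G v < n.
Proof.
rewrite -[ltnRHS]card_ord (cardD1 v) inE add1n ltnS.
rewrite /degree -(card_imset _ val_inj).
apply: leq_trans (leq_imset_card (fun u => [set v; u]%SET) _).
apply/subset_leq_card/fintype.subsetP => x /imsetP[e]; rewrite inE.
case/andP=> _ ve ->; have /cards2P[y [z [yz eE]]] := valP e.
rewrite eE !inE in ve *; case/orP: ve => /eqP ->; apply/imsetP.
  by exists z; rewrite // !inE eq_sym yz.
by exists y; rewrite ?inE ?yz // finset.setUC.
Qed.

Lemma max_degree_leq (n : nat) (G : graph n) : max_degree G <= n.
Proof. by apply/bigmax_leqP => v _; exact/ltnW/degree_ltn. Qed.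

Lemma bigminnP (I : finType) (P : pred I) (F : I -> nat) (m : nat) :
    (exists i, P i) -> (forall i, P i -> F i <= m) ->
  (exists2 i, P i & \big[minn/m]_(i | P i) F i = F i) /\
  (forall i, P i -> \big[minn/m]_(i | P i) F i <= F i).
Proof.
move=> [i0 Pi0] Fm.
have lb i : P i -> \big[minn/m]_(j | P j) F j <= F i.
  by move=> Pi; have := bigmin_le_cond m F Pi; rewrite minEnat leEnat.
split=> //; case: (arg_minnP F Pi0) => i Pi iP; exists i => //.
apply/eqP; rewrite eqn_leq lb //=.
by elim/big_ind: _ => [||j /iP//]; [exact: Fm | move=> x y; rewrite leq_min => -> ->].
Qed.

Lemma min_degreeP (n : nat) (G : graph n) : 0 < n ->
  (exists v, min_degree G = degree G v) /\
  (forall v, min_degree G <= degree G v).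
Proof.
move=> n_gt0.
have [||[v _ vE] lb] := @bigminnP 'I_n xpredT (degree G) n.
- by exists (Ordinal n_gt0).
- by move=> v _; exact/ltnW/degree_ltn.
by split=> [|u]; [exists v | exact: lb].
Qed.

Lemma hamiltonian0 (n : nat) : ~~ hamiltonian (finset.set0 : graph n).
Proof.
apply/negP => /andP[n_gt2 /existsP[[[|x [|y c]] /= /eqP sz]]].
- by exfalso; move: n_gt2; rewrite -sz.
- by exfalso; move: n_gt2; rewrite -{1}sz.
by case/and3P => _ /existsP[e]; rewrite inE.
Qed.

Lemma local_resilience_hamP (n : nat) (G : graph n) :
  let r := local_resilience (@hamiltonian n) G in
  (exists H : graph n,
     [/\ H \subset G, ~~ hamiltonian (G :\: H : graph n)%SET & max_degree H = r]) /\
  (forall H : graph n,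
     H \subset G -> ~~ hamiltonian (G :\: H : graph n)%SET -> r <= max_degree H).
Proof.
have [||[H /andP[HG nH] rE] lb] := @bigminnP (graph n)
  (fun H => (H \subset G) && ~~ hamiltonian (G :\: H : graph n)%SET)
  (@max_degree n) n.
- by exists G; rewrite fintype.subxx finset.setDv hamiltonian0.
- by move=> H _; exact: max_degree_leq.
by split=> [|K KG nK]; [exists H; split | apply: lb; rewrite KG].
Qed.

Lemma Gnp_probT (n : nat) (R : realType) (p : R) :
  Gnp_prob p (fun _ : graph n => true) = 1%R.
Proof.
transitivity (\prod_(e : edge n) (p + (1 - p)))%R; last first.
  by rewrite big1 // => e _; rewrite addrC subrK.
by rewrite bigA_distr; apply: eq_bigl => G; rewrite inE.
Qed.

(* Main.v *)
From mathcomp Require Import all_boot.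
From mathcomp Require Import zify boolp.
Require Import Defs.
Set Implicit Arguments.
Unset Strict Implicit.
Unset Printing Implicit Defensive.

(** Expose G = G(n, p) in two independent colours, red with a 1/50 share of the
edges. As p <= 1.02 ln n / n, a second moment computation gives a vertex of degree
at most ln n / 200, so that an adversary H with D(H) <= d(G) - 2 deletes at most
ln n / 200 edges at each vertex and leaves minimum degree 2. The surviving red
graph, together with at most 20 surviving edges at each vertex, is an expander
with |N(S)| >= 2|S| for |S| <= n/5: large sets expand because red cuts are larger
than what H can delete, small sets because G is locally sparse and its vertices of
low degree are far apart. By Posa's rotations a non-Hamiltonian supergraph has at
least n^2/50 boosters, and a union bound over all such sparse supergraphs shows
that H cannot contain all their blue boosters. Hence boosters can be added until
the graph is Hamiltonian. Conversely, deleting all edges but one at a vertex of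
minimum degree destroys all Hamilton cycles. *)

(** * Rotations of longest paths *)

(** Every probabilistic fact is stated without reference to H, so the choice of H is dealt with
    deterministically. With L = ln n and m = L/200 rounded down, three demands fix the constants.
    The expected number of vertices of degree at most m is at least about n e^(4.5m) e^(-np), which
    grows because 4.5/200 exceeds the 0.02 allowed in np; this is the use of 1.02. Red cuts must
    beat the m|S| deletions at S, and also the choice of S; the latter costs only a power of L per
    vertex when |S| > n/L^4, so the two expansion arguments meet at this size. Finally, the expander
    depends on G and H, so its boosters have to be controlled for all candidates at once. A pair of
    graphs, red and blue, is independent of the colours of its boosters, and the union bound is
    affordable because red graphs are few (the share 1/50) and the blue part has only O(n) edges.
    For this reason the expander takes all surviving red edges but boundedly many others per
    vertex. *)

Section Consecutive.
Variable T : eqType.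
Implicit Types (x y u v : T) (s : seq T).

Fixpoint consecutive x y s :=
  if s is u :: s' then ((u == x) && (ohead s' == Some y)) || consecutive x y s'
  else false.

Lemma consecutive_cat x y s1 u s2 :
  consecutive x y (s1 ++ u :: s2) =
  consecutive x y (rcons s1 u) || consecutive x y (u :: s2).
Proof.
elim: s1 => [|v s1 IH] /=; first by rewrite andbF.
rewrite IH /= !orbA; congr (_ || _ || _ || _).
by case: s1 {IH}.
Qed.

Lemma consecutive_rcons x y s u v :
  consecutive x y (rcons (rcons s u) v) =
  consecutive x y (rcons s u) || ((u == x) && (v == y)).
Proof.
rewrite -cats1 cat_rcons consecutive_cat /= !andbF !orbF.
by congr (_ || (_ && _)); apply/eqP/eqP => [[]|->].
Qed.

Lemma consecutive_rev x y s : consecutive x y (rev s) = consecutive y x s.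
Proof.
elim: s => [|u [|v s] IH] //; first by rewrite /rev /= !andbF.
rewrite [in LHS]rev_cons [in LHS]rev_cons consecutive_rcons -rev_cons IH.
rewrite [RHS]/= orbC; congr (_ || _); rewrite andbC.
by congr (_ && _); apply/eqP/eqP => [->|[]].
Qed.

Lemma mem_consecutive x y s : consecutive x y s -> (x \in s) && (y \in s).
Proof.
elim: s => //= z s IH /orP[/andP[/eqP->]|/IH/andP[xs ys]]; last first.
  by rewrite !inE xs ys !orbT.
by case: s {IH} => //= w s /eqP[->]; rewrite !inE !eqxx orbT.
Qed.

Lemma index_consecutive x y s :
  uniq s -> consecutive x y s -> index y s = (index x s).+1.
Proof.
elim: s => [|u s IH] //= /andP[us Us] /orP[/andP[/eqP<- ys]|xys].
  rewrite eqxx; case: s ys us {IH Us} => //= v s /eqP[<-].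
  by rewrite eqxx inE negb_or => /andP[/negPf-> _].
have /andP[xs ys] := mem_consecutive xys.
rewrite IH //; have [uy|_] := u =P y; first by rewrite uy ys in us.
by have [ux|//] := u =P x; rewrite ux xs in us.
Qed.

End Consecutive.

Section Rotation.
Variables (T : finType) (e : rel T).
Hypothesis e_sym : symmetric e.
Implicit Types (x y u v : T) (s q : seq T) (S : {set T}).

Definition out_nbh S := [set v in ~: S | [exists u in S, e u v]].

(** Posa rotations that fix the first vertex: the chord from the last vertex back to [y] replaces
    the path edge leaving [y], which reverses the tail after [y]. *)
Inductive rotated (s0 : seq T) : seq T -> Prop :=
| rotated_refl : rotated s0 s0
| rotated_step s1 y q : rotated s0 (s1 ++ y :: q) -> e (last y q) y ->
    rotated s0 (s1 ++ y :: rev q).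

Lemma rotatedP s0 s : rotated s0 s -> uniq s0 -> sorted e s0 ->
  [/\ perm_eq s s0, sorted e s & forall x, head x s = head x s0].
Proof.
move=> rs U S; elim: rs => [|s1 y q _ [pe ss hd] eqy]; first by split.
split.
- by rewrite -(permPr pe) perm_cat2l perm_cons perm_rev.
- move: ss; rewrite !sorted_cat_cons => /andP[->/=].
  case/lastP: q eqy {pe hd} => // q z; rewrite last_rcons rev_rcons /= => ezy.
  rewrite rcons_path => /andP[pq lz]; rewrite e_sym ezy /=.
  case: q pq lz => // w q /=.
  move=> /andP[ew pq] lz.
  have := rev_path e w (rcons q z); rewrite last_rcons belast_rcons => ->.
  by rewrite (eq_path (e' := e)) ?rcons_path ?pq ?lz // => a b; rewrite e_sym.
- by move=> x; rewrite -hd; case: (s1).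
Qed.

Definition rotation_ends (s0 : seq T) : {set T} :=
  [set b | `[< exists s, rotated s0 (rcons s b) >]].

Lemma rotation_endsP s0 b :
  reflect (exists s, rotated s0 (rcons s b)) (b \in rotation_ends s0).
Proof. by rewrite inE; apply: asboolP. Qed.

(** A rotation at [y] exchanges the path edge from [y] to [c] for one from [y] to the last vertex,
    and both [c] and the last vertex are ends. So the path edges at a non-end [v] can change only if
    [y] is [v]; then [c] would be a path neighbour of [v], by induction already on [s0], against the
    hypothesis. *)
Lemma rotated_consecutive s0 s v x :
  uniq s0 -> sorted e s0 ->
  v \notin rotation_ends s0 ->
  (forall u, u \in rotation_ends s0 ->
     ~~ (consecutive v u s0 || consecutive u v s0)) ->
  rotated s0 s ->
  (consecutive v x s || consecutive x v s) =
  (consecutive v x s0 || consecutive x v s0).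
Proof.
move=> U S vR nR rs; elim: rs x => [//|s1 y q rq IH ey] x.
case: q rq IH ey => [//|c q] rq IH ey.
have cR : c \in rotation_ends s0.
  apply/rotation_endsP; exists (s1 ++ y :: rev q).
  by rewrite -cats1 -catA /= cats1 -rev_cons; apply: rotated_step.
have bR : last c q \in rotation_ends s0.
  by apply/rotation_endsP; exists (s1 ++ y :: belast c q);
     rewrite rcons_cat rcons_cons -lastI.
have vy : v != y.
  apply: contraTneq (nR _ cR) => vy.
  by rewrite -IH vy consecutive_cat /= !eqxx orbT.
have vc : v != c by apply: contraNneq vR => ->.
have vb : v != last c q by apply: contraNneq vR => ->.
rewrite -IH !(consecutive_cat _ _ s1).
set q1 := c :: q; rewrite /= !consecutive_rev.
have -> : (y == v) = false by apply/negbTE; rewrite eq_sym.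
have -> : (Some c == Some v) = false.
  by apply/negbTE; apply: contra vc => /eqP[->].
have -> : (ohead (rev q1) == Some v) = false.
  apply/negbTE; apply: contra vb; rewrite /q1 lastI rev_rcons /=.
  by move=> /eqP[->].
by rewrite !andbF /= orbACA [X in _ || X]orbC orbACA.
Qed.

(* Posa: otherwise the two path edges at [v] survive every rotation, and rotating
   at [v] makes one of its neighbours on the original path an end. *)
Lemma out_nbh_rotation_ends s0 v :
  uniq s0 -> sorted e s0 ->
  (forall s, uniq s -> sorted e s -> size s <= size s0) ->
  v \in out_nbh (rotation_ends s0) ->
  exists2 u, u \in rotation_ends s0 & consecutive v u s0 || consecutive u v s0.
Proof.
move=> U S maxs; rewrite !inE => /andP[vR /exists_inP[b bR ebv]].
have {}vR : v \notin rotation_ends s0 by rewrite inE.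
apply: contrapT => nex.
have nR u : u \in rotation_ends s0 ->
    ~~ (consecutive v u s0 || consecutive u v s0).
  by move=> uR; apply/negP => H; apply: nex; exists u.
have /rotation_endsP[s rs] := bR.
have [pe ss _] := rotatedP rs U S.
have Us : uniq (rcons s b) by rewrite (perm_uniq pe).
have vs : v \in rcons s b.
  apply: contraT => vs.
  suff : size (rcons (rcons s b) v) <= size s0.
    by rewrite size_rcons (perm_size pe) ltnn.
  apply: maxs; first by rewrite rcons_uniq vs.
  case: (s) ss => [|a s'] /=; first by rewrite ebv.
  by rewrite !rcons_path !last_rcons ebv andbT => ->.
have vb : v != b by apply: contraNneq vR => ->.
rewrite mem_rcons inE (negPf vb) /= in vs.
case/splitPr: vs rs Us ss pe => s1 q rs _ _ _.
rewrite rcons_cat rcons_cons in rs.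
have [c [q' qE]] : exists c q', rcons q b = c :: q'.
  by case: (q) => [|c q']; [exists b, [::] | exists c, (rcons q' b)].
have cR : c \in rotation_ends s0.
  apply/rotation_endsP; exists (s1 ++ v :: rev q').
  rewrite -cats1 -catA /= cats1 -rev_cons -qE; apply: rotated_step => //.
  by rewrite last_rcons.
have := nR _ cR; rewrite -(rotated_consecutive c U S vR nR rs).
by rewrite qE consecutive_cat /= !eqxx !orbT.
Qed.

(** Every outer neighbour is the successor or the predecessor on [s0] of some end. The inequality is
    strict because the last vertex of [s0] is an end without a successor. *)
Lemma card_out_nbh_rotation_ends s0 : s0 != [::] ->
  uniq s0 -> sorted e s0 ->
  (forall s, uniq s -> sorted e s -> size s <= size s0) ->
  #|out_nbh (rotation_ends s0)| < 2 * #|rotation_ends s0|.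
Proof.
case/lastP: s0 => // s1 b _ U S maxs; set s0 := rcons s1 b in U S maxs *.
set Rs := rotation_ends s0.
have bR : b \in Rs by apply/rotation_endsP; exists s1; apply: rotated_refl.
pose nx u := nth b s0 (index u s0).+1.
pose pv u := nth b s0 (index u s0).-1.
have sub : out_nbh Rs \subset nx @: (Rs :\ b) :|: pv @: Rs.
  apply/subsetP => v vN.
  have [u uR /orP[] /[dup] cs /mem_consecutive/andP[vs us]] :=
    out_nbh_rotation_ends U S maxs vN; rewrite inE; apply/orP.
  - right; apply/imsetP; exists u => //.
    by rewrite /pv (index_consecutive U cs) /= nth_index.
  - left; apply/imsetP; exists u; last by rewrite /nx -(index_consecutive U cs) nth_index.
    rewrite !inE; apply/andP; split; last by rewrite inE in uR.
    apply: contraTneq cs => ->; apply/negP => /(index_consecutive U).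
    have := us; rewrite -index_mem => + E; rewrite E size_rcons ltnS.
    have -> : index b s0 = size s1.
      rewrite /s0 -cats1 index_cat /= eqxx addn0.
      by move: U; rewrite rcons_uniq => /andP[/negPf->].
    by rewrite ltnn.
apply: leq_ltn_trans (subset_leq_card sub) _.
apply: leq_ltn_trans (leq_card_setU _ _) _.
rewrite mul2n -addnn [X in _ < X + _](cardsD1 b) bR addSn ltnS.
by rewrite leq_add ?leq_imset_card.
Qed.

Lemma rotation_ends_large k s0 : s0 != [::] ->
  (forall S, #|S| <= k -> 2 * #|S| <= #|out_nbh S|) ->
  uniq s0 -> sorted e s0 ->
  (forall s, uniq s -> sorted e s -> size s <= size s0) ->
  k < #|rotation_ends s0|.
Proof.
move=> s0n ex U S maxs; rewrite ltnNge; apply/negP => /ex.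
by rewrite leqNgt card_out_nbh_rotation_ends.
Qed.

End Rotation.

(* The finType of a set type may be inferred as a [reverse_coercion] redex, which
   hides from lia that two cardinals are the same. *)
Ltac cardlia := unfold reverse_coercion in *; lia.

(** * Graphs, Hamilton cycles and boosters *)

Section Graphs.
Variable n : nat.
Implicit Types (G H : graph n) (u v x y : 'I_n) (e f : edge n).

Definition nbrs G u := [set v | adj G u v].

Lemma adj_sym G : symmetric (adj G).
Proof. by move=> u v; rewrite /adj; under eq_existsb do rewrite setUC. Qed.

Lemma adj_neq G u v : adj G u v -> u != v.
Proof.
case/exists_inP=> e _ /eqP ev; have := valP e; rewrite /= ev cards2.
by case: (u != v).
Qed.

Lemma mkedge_subproof u v : u != v -> #|[set u; v]| == 2.
Proof. by move=> uv; rewrite cards2 uv. Qed.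

Definition mkedge u v (uv : u != v) : edge n :=
  exist (fun e : {set 'I_n} => is_true (#|e| == 2)) [set u; v] (mkedge_subproof uv).

Lemma edgeP e : exists u v (uv : u != v), e = mkedge uv.
Proof.
have /cards2P[u [v [uv eE]]] := valP e.
by exists u, v, uv; apply: val_inj.
Qed.

Lemma adjE G u v (uv : u != v) : adj G u v = (mkedge uv \in G).
Proof.
apply/exists_inP/idP => [[e eG /eqP ev]|uvG]; last by exists (mkedge uv).
by rewrite (_ : mkedge uv = e) //; apply: val_inj.
Qed.

Lemma adjS G H : G \subset H -> subrel (adj G) (adj H).
Proof.
move=> /subsetP GH u v /[dup] /adj_neq uv.
by rewrite !(adjE _ uv) => /GH.
Qed.

Lemma degreeE G v : degree G v = #|nbrs G v|.
Proof.
rewrite /degree -(card_imset _ val_inj).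
have inj : {in nbrs G v &, injective (fun u => [set v; u])}.
  move=> x y; rewrite !inE => /adj_neq vx /adj_neq vy /setP/(_ x).
  by rewrite !inE eqxx orbT eq_sym (negPf vx) /= => /esym/eqP.
rewrite -(card_in_imset inj); apply: eq_card => s; apply/imsetP/imsetP.
- case=> e; rewrite inE => /andP[eG ve] ->.
  have [x [y [xy eE]]] := edgeP e; rewrite eE !inE /= in eG ve *.
  case/orP: ve => /eqP vE; rewrite vE; [exists y|exists x] => //.
  + by rewrite inE (adjE _ xy).
  + by rewrite inE adj_sym (adjE _ xy).
  + by rewrite setUC.
- case=> u; rewrite inE => /[dup] /adj_neq vu; rewrite (adjE _ vu) => vuG ->.
  by exists (mkedge vu) => //; rewrite inE vuG !inE eqxx.
Qed.

Lemma sum_degree G : \sum_v degree G v = 2 * #|G|.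
Proof.
rewrite /degree; under eq_bigr do rewrite -sum1_card.
rewrite (exchange_big_dep (mem G)) /=; last by move=> v e _; rewrite inE => /andP[].
rewrite mulnC -sum_nat_const; apply: eq_bigr => e eG.
rewrite sum1dep_card -[RHS](eqP (valP e)); apply: eq_card => v.
by rewrite !inE eG.
Qed.

Lemma degreeD G H v : degree G v <= degree (G :\: H : graph n) v + degree H v.
Proof.
rewrite /degree; apply: leq_trans (leq_card_setU _ _).
apply/subset_leq_card/subsetP => e; rewrite !inE => /andP[eG ve].
by rewrite ve eG !andbT; case: (e \in H).
Qed.

Lemma leq_degree_max G v : degree G v <= max_degree G.
Proof. exact: (leq_bigmax v). Qed.

Lemma hamiltonianS G H : G \subset H -> hamiltonian G -> hamiltonian H.
Proof.
move=> GH /andP[n2 /existsP[c /andP[Uc cc]]]; rewrite /hamiltonian n2 /=.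
by apply/existsP; exists c; rewrite Uc (sub_cycle (adjS GH)).
Qed.

Lemma hamiltonian_degree G v : hamiltonian G -> 1 < degree G v.
Proof.
move=> /andP[n2 /existsP[c /andP[Uc cc]]].
have vc : v \in c.
  suff /(_ v) -> : mem c =i predT by [].
  by apply/subset_cardP; rewrite ?subset_predT // cardT size_enum_ord (card_uniqP Uc) size_tuple.
case: (rot_to vc) => i q cE.
have sq : (size q).+1 = n by have := size_rot i c; rewrite cE size_tuple.
move: Uc cc; rewrite -(rot_uniq i) -(rot_cycle i) cE {cE}.
case: q sq => [|x q] sq; first by move: n2 sq => /=; lia.
case/lastP: q sq => [|q y]; first by move: n2 => /=; lia.
move=> _ /= /andP[_ /andP[xq _]]; rewrite !rcons_path !last_rcons.
case/and3P=> vx _ yv; rewrite degreeE.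
have xy : x != y by apply: contraNneq xq => ->; rewrite mem_rcons inE eqxx.
have <- : #|[set x; y]| = 2 by rewrite cards2 xy.
apply/subset_leq_card/subsetP => u; rewrite !inE.
by case/orP => /eqP->; rewrite // adj_sym.
Qed.

Lemma uniq_size_ord (s : seq 'I_n) : uniq s -> size s <= n.
Proof. by move=> /card_uniqP <-; rewrite -[n in _ <= n]card_ord max_card. Qed.

(** Lengths count vertices, so a Hamilton path has value [n]. *)
Definition longest_path G : nat :=
  \max_(k < n.+1 | [exists t : k.-tuple 'I_n, uniq t && sorted (adj G) t]) k.

Lemma longest_path_max G s :
  uniq s -> sorted (adj G) s -> size s <= longest_path G.
Proof.
move=> Us ss.
have sn : size s < n.+1 by rewrite ltnS uniq_size_ord.
apply: (@leq_bigmax_cond _ _ (fun k : 'I_n.+1 => k : nat) (Ordinal sn)).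
by apply/existsP; exists (in_tuple s); rewrite Us.
Qed.

Lemma longest_pathP G :
  exists s, [/\ uniq s, sorted (adj G) s & size s = longest_path G].
Proof.
have [|k /existsP[t /andP[Ut st]] kE] :=
  @eq_bigmax_cond _ (fun k : 'I_n.+1 => [exists t : k.-tuple 'I_n, uniq t && sorted (adj G) t]) (fun k => k : nat).
  by apply/card_gt0P; exists ord0; apply/existsP; exists [tuple].
by exists t; rewrite Ut st size_tuple /longest_path kE.
Qed.

(** Closing a Hamilton path to a cycle yields no longer path, hence the first alternative. *)
Definition boosters G : graph n :=
  [set f | (f \notin G) &&
     (hamiltonian (f |: G : graph n) || (longest_path G < longest_path (f |: G)))].

Definition connected_graph G :=
  forall S : {set 'I_n}, S != set0 -> S != setT ->
  exists u v, [/\ u \in S, v \notin S & adj G u v].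

Definition expander k G :=
  forall S : {set 'I_n}, #|S| <= k -> 2 * #|S| <= #|out_nbh (adj G) S|.

Lemma expanderS k G H : G \subset H -> expander k G -> expander k H.
Proof.
move=> GH ex S /ex/leq_trans; apply; apply/subset_leq_card/subsetP => v.
rewrite !inE => /andP[-> /exists_inP[u uS uv]].
by apply/exists_inP; exists u => //; apply: adjS uv.
Qed.

(** A nonempty set that no edge leaves has more than k vertices, hence contains a k-set together
    with its at least 2k outer neighbours. A disconnection would give two complementary sets of this
    kind and thus 6k <= n. *)
Lemma expander_connected k G : 0 < k -> n < 6 * k -> expander k G ->
  connected_graph G.
Proof.
move=> k0 nk ex S S0 ST; apply: contrapT => nex.
have closed (C : {set 'I_n}) : C != set0 ->
    (forall u v, u \in C -> v \notin C -> ~~ adj G u v) -> 3 * k <= #|C|.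
  move=> C0 Cc; have [Ck|kC] := leqP #|C| k.
    have := ex _ Ck; suff -> : out_nbh (adj G) C = set0.
      by rewrite cards0 leqn0 muln_eq0 cards_eq0 (negPf C0).
    apply/setP => v; rewrite !inE; apply/negP => /andP[vC /exists_inP[u uC uv]].
    by move: (Cc _ _ uC vC); rewrite uv.
  have [B BC Bk] : exists2 B : {set 'I_n}, B \subset C & #|B| = k.
    have /set0Pn[B] : [set B : {set 'I_n} | B \subset C & #|B| == k] != set0.
      by rewrite -card_gt0 cards_draws bin_gt0 ltnW.
    by rewrite inE => /andP[BC /eqP]; exists B.
  have := ex B; rewrite Bk => /(_ (leqnn k)) NB.
  suff : #|B :|: out_nbh (adj G) B| <= #|C|.
    have dis : B :&: out_nbh (adj G) B = set0.
      by apply/setP => v; rewrite !inE; case: (v \in B).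
    by rewrite cardsU dis cards0 Bk; cardlia.
  apply/subset_leq_card/subsetP => v; rewrite !inE.
  case/orP => [/(subsetP BC)//|/andP[_ /exists_inP[u uB uv]]].
  apply: contraLR uv => vC; apply: Cc => //; exact: (subsetP BC).
have h1 : 3 * k <= #|S|.
  apply: closed => // u v uS vS; apply/negP => uv; apply: nex.
  by exists u, v.
have h2 : 3 * k <= #|~: S|.
  apply: closed => [|u v]; first by apply: contra_neq ST => SC; rewrite -[S]setCK SC setC0.
  rewrite !inE negbK => uS vS; apply/negP => uv; apply: nex.
  by exists v, u; rewrite adj_sym.
by have := cardsC S; rewrite card_ord; cardlia.
Qed.

(** Some edge of the connected graph [G] leaves the cycle; opening the cycle at the foot of this
    edge gives a path with one more vertex. *)
Lemma cycle_extension G H c : connected_graph G -> G \subset H ->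
  uniq c -> c != [::] -> cycle (adj H) c -> size c < n ->
  size c < longest_path H.
Proof.
move=> cG GH Uc c0 cc cn.
have [||u [v [+ + uv]]] := cG [set x in c].
- by case: c c0 {Uc cc cn} => // x c _; apply/set0Pn; exists x; rewrite !inE eqxx.
- apply: contraTneq cn => cT; rewrite -leqNgt.
  by rewrite -(card_uniqP Uc) -cardsE cT cardsT card_ord.
rewrite !inE => uc vc; case: (rot_to uc) => i q cE.
have -> : (size c).+1 = size [:: v, u & q] by rewrite /= -(size_rot i c) cE.
apply: longest_path_max.
  by rewrite cons_uniq -cE rot_uniq mem_rot vc.
move: cc; rewrite -(rot_cycle i) cE /= rcons_path => /andP[-> _].
by rewrite andbT adj_sym; apply: adjS uv.
Qed.

Lemma closing_edge_booster G s a b (ab : a != b) :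
  connected_graph G -> 2 < n -> ~~ hamiltonian G ->
  uniq (a :: s) -> path (adj G) a s -> last a s = b ->
  size (a :: s) = longest_path G -> mkedge ab \in boosters G.
Proof.
move=> cG n2 nH Us ps sb sl.
(* Two instances are used. With the edge [ab] added to [G] it yields the booster property; with [H]
   equal to [G] it shows that [ab] is not in [G], as [G] is not Hamiltonian and has no path longer
   than its longest one. *)
have key H : G \subset H -> mkedge ab \in H ->
    hamiltonian H || (longest_path G < longest_path H).
  move=> GH abH.
  have cs : cycle (adj H) (a :: s).
    rewrite /= rcons_path (sub_path (adjS GH) ps) sb adj_sym.
    by rewrite (adjE _ ab).
  have [sn|sn] := ltnP (size (a :: s)) n.
    by rewrite -sl (cycle_extension cG GH) ?orbT.
  have {}sn : size (a :: s) == n.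
    by rewrite eqn_leq sn andbT uniq_size_ord.
  apply/orP; left; rewrite /hamiltonian n2; apply/existsP; exists (Tuple sn).
  by rewrite /= in Us cs *; rewrite Us cs.
rewrite inE; apply/andP; split; last by apply: key; rewrite ?subsetUr ?setU11.
by apply: contra nH => /(key _ (subxx _)); rewrite ltnn orbF.
Qed.

(** Posa's argument applied twice: rotations of one longest path produce more than k ends [a], and
    rotations of each resulting path, reversed so as to start at [a], produce more than k ends [b].
    Each pair [ab] is a booster, so more than k vertices have degree more than k in the booster
    graph. *)
Lemma card_boosters k G : 0 < k -> n < 6 * k -> 2 < n -> expander k G ->
  ~~ hamiltonian G -> k.+1 ^ 2 <= 2 * #|boosters G|.
Proof.
move=> k0 nk n2 ex nH; have cG := expander_connected k0 nk ex.
have [s [Us ss sl]] := longest_pathP G.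
have maxs s' : uniq s' -> sorted (adj G) s' -> size s' <= size s.
  by rewrite sl; apply: longest_path_max.
have s0 : s != [::].
  apply: contraTneq (ltnW (ltnW n2)) => s0; rewrite -leqNgt.
  by have := maxs [:: Ordinal (ltnW (ltnW n2))] isT isT; rewrite s0.
have rotP t s' b : rotated (adj G) t (rcons s' b) -> uniq t -> sorted (adj G) t ->
    size t = longest_path G ->
    [/\ uniq (rcons s' b), sorted (adj G) (rcons s' b), size (rcons s' b) = longest_path G
      & forall x, head x (rcons s' b) = head x t].
  move=> rt Ut st tl.
  have [pe ss' hd] := rotatedP (@adj_sym G) rt Ut st.
  by rewrite (perm_uniq pe) (perm_size pe).
have large t : t != [::] -> uniq t -> sorted (adj G) t -> size t = longest_path G ->
   k < #|rotation_ends (adj G) t|.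
  move=> t0 Ut st tl; apply: rotation_ends_large => // [|s' Us' ss'].
    exact: adj_sym.
  by rewrite tl -sl maxs.
have R0 := large s s0 Us ss sl; set Rs := rotation_ends _ _ in R0.
have degb a : a \in Rs -> k < degree (boosters G) a.
  move=> /rotation_endsP[s1 rs].
  have [U1 S1 L1 _] := rotP _ _ _ rs Us ss sl.
  set t := rev (rcons s1 a).
  have Ut : uniq t by rewrite rev_uniq.
  have St : sorted (adj G) t.
    by rewrite rev_sorted (eq_sorted (e' := adj G)) // => x y; rewrite adj_sym.
  have Lt : size t = longest_path G by rewrite size_rev.
  have tE : t = a :: rev s1 by rewrite /t rev_rcons.
  have t0 : t != [::] by rewrite tE.
  apply: leq_trans (large t t0 Ut St Lt) _; rewrite degreeE.
  apply/subset_leq_card/subsetP => b /rotation_endsP[s2 r2].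
  have [U2 S2 L2 hd] := rotP _ _ _ r2 Ut St Lt.
  (* A longest path with a single vertex is impossible, since connectivity provides an edge. *)
  case: s2 {r2} U2 S2 L2 hd => [|a' s2] U2 S2 L2 hd.
    have [||u [v [_ _ uv]]] := cG [set b].
    - by apply/set0Pn; exists b; rewrite inE.
    - apply: contraTneq n2 => bT; rewrite -leqNgt -[n in n <= _]card_ord.
      by rewrite -cardsT -bT cards1.
    have := longest_path_max (G := G) (s := [:: u; v]).
    by rewrite /= inE (adj_neq uv) uv -L2 => /(_ isT isT).
  have a'E : a' = a by have := hd a; rewrite tE.
  rewrite a'E in U2 S2 L2 *.
  have ab : a != b.
    by move: U2; rewrite /= mem_rcons inE negb_or => /andP[/andP[]].
  rewrite inE (adjE _ ab); apply: (closing_edge_booster (s := rcons s2 b)) => //.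
  by rewrite last_rcons.
rewrite -sum_degree (bigID (mem Rs)) /=; apply: leq_trans (leq_addr _ _).
apply: leq_trans (_ : \sum_(a in Rs) k.+1 <= _); last exact: leq_sum.
by rewrite sum_nat_const -mulnn leq_mul2r R0 orbT.
Qed.

End Graphs.

(** * Expansion of sparse subgraphs *)

Section Expansion.
Variable n : nat.
Implicit Types (G H X : graph n) (u v x y : 'I_n) (e f : edge n).
Implicit Types (S T U W Z A : {set 'I_n}).

Definition edges_in G W : graph n := [set e in G | val e \subset W].

Definition edge_cut S U : graph n :=
  [set e | [exists u in S, exists v in U, val e == [set u; v]]].

Lemma nbrs_edges_in G W u : u \in W -> nbrs (edges_in G W) u = nbrs G u :&: W.
Proof.
move=> uW; apply/setP => v; rewrite !inE.
have [<-|uv] := eqVneq u v.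
  by rewrite !(contraTF (@adj_neq _ _ _ _)) ?eqxx.
rewrite !(adjE _ uv) inE; case: (_ \in G) => //=.
by rewrite subUset !sub1set uW.
Qed.

Lemma card_edges_in_add G W v : v \notin W ->
  #|edges_in G W| + #|nbrs G v :&: W| <= #|edges_in G (v |: W)|.
Proof.
move=> vW.
have -> : nbrs G v :&: W = nbrs (edges_in G (v |: W)) v.
  rewrite nbrs_edges_in ?setU11 //; apply/setP => u; rewrite !inE.
  by case: eqP => [->|//]; rewrite (contraTF (@adj_neq _ _ _ _)) ?eqxx.
rewrite -degreeE /degree.
have dis : [disjoint edges_in G W & [set e in edges_in G (v |: W) | v \in val e]].
  rewrite -setI_eq0; apply/eqP/setP => e; rewrite !inE; apply/negP.
  case/andP=> /andP[_ eW] /andP[_ ve]; move: vW.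
  by rewrite (subsetP eW).
rewrite -cardsUI (eqP (_ : _ :&: _ == set0)) ?setI_eq0 // cards0 addn0.
apply/subset_leq_card/subsetP => e; rewrite !inE => /orP[/andP[-> eW]|/andP[]//].
exact: subset_trans eW (subsetUr _ _).
Qed.

Lemma card_cut_degree X S U : #|X :&: edge_cut S U| <= \sum_(u in S) degree X u.
Proof.
rewrite /degree; under eq_bigr do rewrite -sum1_card.
rewrite (exchange_big_dep (mem X)) /=; last by move=> ? ? _; rewrite inE => /andP[].
rewrite -sum1_card (bigID (mem X)) /= [X in _ + X]big1 ?addn0; last first.
  by move=> e; rewrite inE => /andP[/andP[->]].
rewrite [leqRHS](bigID (mem (X :&: edge_cut S U))) /=; apply: leq_trans (leq_addr _ _).
rewrite (eq_bigl (fun e => (e \in X) && (e \in X :&: edge_cut S U))); last first.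
  by move=> e; rewrite andbC.
apply: leq_sum => e /andP[eX]; rewrite inE => /andP[_].
rewrite inE => /exists_inP[u uS /exists_inP[v vU /eqP euv]].
by rewrite (bigD1 u) //= uS inE eX euv !inE eqxx.
Qed.

Variables (G : graph n) (D : nat).

Definition low_degree : {set 'I_n} := [set v | degree G v < D].

(** One count encodes two separation properties. For [A] a singleton, no connected set of at most 5
    vertices that spans a cycle contains a vertex of low degree; for [A] a pair, no connected set of
    at most 5 vertices contains two of them. *)
Hypothesis low_sparse : forall W A, A \subset W -> A != set0 -> #|W| <= 5 ->
  A \subset low_degree -> #|edges_in G W| + #|A| <= #|W|.

(** A counting substitute for connectedness of the induced graph: it survives the addition of a
    neighbour, and it is all that has to be compared with [low_sparse]. *)
Let conn W := #|W| <= #|edges_in G W|.+1.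

Let conn1 u : conn [set u].
Proof. by rewrite /conn cards1. Qed.

Let conn_add W u v : conn W -> u \in W -> (v \in W) || adj G v u ->
  conn (v |: W).
Proof.
move=> cW uW vu; have [vW|vW] := boolP (v \in W).
  by rewrite (setUidPr _) // sub1set.
rewrite /conn cardsU1 vW add1n ltnS.
apply: leq_trans cW _; apply: leq_trans (card_edges_in_add G vW).
rewrite -addn1 leq_add2l card_gt0; apply/set0Pn; exists u.
by rewrite !inE uW andbT; move: vu; rewrite (negPf vW).
Qed.

Let conn_add2 W x y v : conn W -> x \in W -> y \in W -> x != y -> v \notin W ->
  adj G v x -> adj G v y -> #|v |: W| <= #|edges_in G (v |: W)|.
Proof.
move=> cW xW yW xy vW vx vy; rewrite cardsU1 vW add1n.
apply: leq_trans (card_edges_in_add G vW).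
apply: leq_trans (_ : (#|edges_in G W|.+1).+1 <= _); first by rewrite ltnS.
rewrite -addn2 leq_add2l; have <- : #|[set x; y]| = 2 by rewrite cards2 xy.
by apply/subset_leq_card/subsetP => z; rewrite !inE => /orP[] /eqP->; apply/andP.
Qed.

Let cardU1 W v : #|v |: W| <= #|W|.+1.
Proof. by rewrite cardsU1; case: (_ \in _). Qed.

Lemma low_conn W v v' : conn W -> #|W| <= 5 -> v \in W -> v' \in W ->
  v \in low_degree -> v' \in low_degree -> v = v'.
Proof.
move=> cW W5 vW v'W vL v'L; apply/eqP; apply: contraT => vv'.
have := @low_sparse W [set v; v']; rewrite cards2 vv' !subUset !sub1set.
rewrite vW v'W vL v'L W5 => /(_ isT) H.
suff : #|W|.+1 <= #|W| by rewrite ltnn.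
apply: leq_trans (_ : #|edges_in G W|.+1.+1 <= _); first by rewrite ltnS.
by rewrite -addn2; apply: H => //; apply/set0Pn; exists v; rewrite !inE eqxx.
Qed.

Lemma low_acyclic W v : #|W| <= 5 -> v \in W -> v \in low_degree ->
  #|edges_in G W| < #|W|.
Proof.
move=> W5 vW vL; have := @low_sparse W [set v].
rewrite cards1 !sub1set vW vL W5 addn1; apply=> //.
by apply/set0Pn; exists v; rewrite inE.
Qed.

Lemma low_degree_independent u v : u \in low_degree -> v \in low_degree ->
  adj G u v -> False.
Proof.
move=> uL vL uv.
have : u = v.
  apply: (low_conn (W := u |: [set v])) => //; rewrite ?inE ?eqxx ?orbT //.
    by apply: conn_add (conn1 v) (set11 v) _; rewrite uv orbT.
  by apply: leq_trans (cardU1 _ _) _; rewrite cards1.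
by move=> E; move: (adj_neq uv); rewrite E eqxx.
Qed.

Lemma low_degree_nbrs_disjoint u v x : u \in low_degree -> v \in low_degree ->
  adj G u x -> adj G v x -> u = v.
Proof.
move=> uL vL ux vx; apply: (low_conn (W := u |: (v |: [set x]))) => //; rewrite ?inE ?eqxx ?orbT //.
  apply: (@conn_add _ x); rewrite ?ux ?orbT // ?inE ?eqxx ?orbT //.
  by apply: conn_add (conn1 x) (set11 x) _; rewrite vx orbT.
by apply: leq_trans (cardU1 _ _) _; rewrite ltnS; apply: leq_trans (cardU1 _ _) _; rewrite cards1.
Qed.

(* Two distinct neighbours of [u] in the union of the closed neighbourhoods of
   the low degree vertices would give either two low degree vertices at distance
   at most 4 or a low degree vertex on a cycle of length at most 4. *)
Lemma low_degree_ball u x y v v' : u \notin low_degree ->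
  v \in low_degree -> v' \in low_degree ->
  adj G u x -> adj G u y -> (x == v) || adj G v x -> (y == v') || adj G v' y ->
  x = y.
Proof.
move=> uL vL v'L ux uy xv yv'; apply/eqP; apply: contraT => xy.
have cx : conn (x |: [set u]).
  by apply: conn_add (conn1 u) (set11 u) _; rewrite adj_sym ux orbT.
have cy : conn (y |: (x |: [set u])).
  by apply: (@conn_add _ u); rewrite ?inE ?eqxx ?orbT // adj_sym uy orbT.
have yW : y \notin x |: [set u].
  by rewrite !inE negb_or eq_sym xy eq_sym (adj_neq uy).
set W := y |: _ in cy.
have cW : #|W| <= 3.
  apply: leq_trans (cardU1 _ _) _; rewrite ltnS.
  by apply: leq_trans (cardU1 _ _) _; rewrite cards1.
have vv' : v = v'.
  have cv : conn (v |: W).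
    apply: (@conn_add _ x); rewrite ?inE ?eqxx ?orbT //.
    by case/orP: xv => [/eqP->|->]; rewrite ?eqxx ?orbT.
  have cv' : conn (v' |: (v |: W)).
    apply: (@conn_add _ y); rewrite ?inE ?eqxx ?orbT //.
    by case/orP: yv' => [/eqP->|->]; rewrite ?eqxx ?orbT.
  apply: (low_conn cv') => //; rewrite ?inE ?eqxx ?orbT //.
  apply: leq_trans (cardU1 _ _) _; rewrite ltnS.
  by apply: leq_trans (cardU1 _ _) _; rewrite ltnS.
rewrite -{v' v'L}vv' in yv'.
have tri z w : conn (w |: [set u]) -> z \notin w |: [set u] -> adj G u z -> adj G z w ->
    adj G u w -> v \in z |: (w |: [set u]) -> False.
  move=> cw zW uz zw uw vW.
  have W5 : #|z |: (w |: [set u])| <= 5.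
    apply: leq_trans (cardU1 _ _) _; rewrite ltnS.
    by apply: leq_trans (cardU1 _ _) _; rewrite cards1.
  have := low_acyclic W5 vW vL; rewrite ltnNge.
  suff -> : #|z |: (w |: [set u])| <= #|edges_in G (z |: (w |: [set u]))| by [].
  apply: (@conn_add2 _ w u) => //; rewrite ?inE ?eqxx ?orbT //; last by rewrite adj_sym.
  by rewrite eq_sym (adj_neq uw).
have [vW|vW] := boolP (v \in W).
  have := vW; rewrite !inE => /or3P[]/eqP vE.
  - move: xv; rewrite vE (negPf xy) /= => yx.
    by case: (tri y x).
  - move: yv'; rewrite vE eq_sym (negPf xy) /= => yx.
    by case: (tri y x); rewrite // adj_sym.
  - by move: uL; rewrite -vE vL.
have vx : adj G v x.
  by case/orP: xv => // /eqP E; move: vW; rewrite -E !inE eqxx orbT.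
have vy : adj G v y.
  by case/orP: yv' => // /eqP E; move: vW; rewrite -E !inE eqxx.
have W5 : #|v |: W| <= 5.
  by apply: leq_trans (cardU1 _ _) _; rewrite ltnS (leq_trans cW).
have := low_acyclic W5 (setU11 _ _) vL; rewrite ltnNge.
by rewrite (conn_add2 cy _ _ xy vW vx vy) // !inE eqxx ?orbT.
Qed.

Variables (X : graph n) (s0 : nat).
Hypothesis XG : X \subset G.
Hypothesis X2 : forall v, 1 < degree X v.
Hypothesis X20 : forall v, v \notin low_degree -> 19 < degree X v.
Hypothesis sparse : forall W, 0 < #|W| <= 4 * s0 -> #|edges_in G W| < 2 * #|W|.

(** The vertices of low degree in [S] have pairwise disjoint neighbourhoods, of size at least 2. By
    [low_degree_ball] every other vertex of [S] loses at most one of its 20 neighbours to [S1] and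
    [M]; local sparsity spreads the remaining 19. *)
Lemma small_expansion S : #|S| <= s0 -> 2 * #|S| <= #|out_nbh (adj X) S|.
Proof.
move=> Ss0; set S1 := S :&: low_degree; set S2 := S :\: low_degree.
have S1L v : v \in S1 -> v \in low_degree by rewrite inE => /andP[].
set M := [set x | [exists v in S1, adj X v x]].
set Z' := [set x | [exists u in S2, adj X u x]] :\: (S :|: M).
have M2 : 2 * #|S1| <= #|M|.
  apply: leq_trans (_ : \sum_(v in S1) #|nbrs X v| <= _).
    rewrite mulnC -sum_nat_const; apply: leq_sum => v _.
    by rewrite -degreeE.
  under eq_bigr do rewrite -sum1_card.
  rewrite (exchange_big_dep (mem M)) /=; last first.
    move=> v x vS1; rewrite !inE => vx.
    by apply/exists_inP; exists v => //; rewrite inE in vS1.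
  rewrite -[leqRHS]sum1_card; apply: leq_sum => x _.
  rewrite sum1dep_card; apply/card_le1_eqP => u v; rewrite !inE.
  move=> /andP[/andP[_ uL] ux] /andP[/andP[_ vL] vx].
  apply: (low_degree_nbrs_disjoint (x := x)); rewrite ?inE //;
  exact: adjS XG _ _ _.
(* The factor is 3 and not 2 because up to |S2| vertices of [M] may lie in [S2] and be lost. If the
   bound failed, [Z] would have fewer than 4|S2| vertices, hence fewer than 8|S2| edges, whereas
   degrees of at least 19 on [S2] force 19|S2|/2. *)
have Z3 : 3 * #|S2| <= #|Z'|.
  rewrite leqNgt; apply/negP => Zlt.
  set Z := S2 :|: Z'; set Y := edges_in G Z.
  have S2S : #|S2| <= #|S| by apply/subset_leq_card/subsetDl.
  have Zc : #|Z| <= #|S2| + #|Z'| by apply: leq_card_setU.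
  have S2Z : #|S2| <= #|Z| by apply/subset_leq_card/subsetUl.
  have YZ : #|Y| < 2 * #|Z| by apply: sparse; cardlia.
  have degY u : u \in S2 -> 19 <= degree Y u.
    move=> uS2; have uL : u \notin low_degree by move: uS2; rewrite inE => /andP[].
    have := X20 uL; rewrite !degreeE nbrs_edges_in; last by rewrite inE uS2.
    rewrite -(cardsID (S1 :|: M) (nbrs X u)) => H.
    have : #|nbrs X u :&: (S1 :|: M)| <= 1.
      apply/card_le1_eqP => y x; rewrite !inE.
      have ball z : (z \in S) && (degree G z < D) ||
          [exists v in S1, adj X v z] -> exists2 v, v \in low_degree & (z == v) || adj G v z.
        case/orP=> [/andP[_ zL]|/exists_inP[v vS1 vz]].
          by exists z; rewrite ?inE ?eqxx.
        by exists v; rewrite ?S1L // (adjS XG vz) orbT.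
      move=> /andP[uy /ball[v' v'L yv']] /andP[ux /ball[v vL xv]].
      exact: (low_degree_ball uL vL v'L (adjS XG ux) (adjS XG uy)).
    have : #|nbrs X u :\: (S1 :|: M)| <= #|nbrs G u :&: Z|.
      apply/subset_leq_card/subsetP => z; rewrite !inE negb_or.
      move=> /andP[/andP[zS1 zM] uz]; rewrite (adjS XG uz) (negPf zM) orbF /=.
      case zS : (z \in S) zS1 => /= zS1; first by rewrite zS1.
      by apply/orP; right; apply/exists_inP; exists u.
    cardlia.
  have : \sum_(u in S2) degree Y u <= 2 * #|Y|.
    by rewrite -sum_degree [leqRHS](bigID (mem S2)) /= leq_addr.
  have : #|S2| * 19 <= \sum_(u in S2) degree Y u.
    by rewrite -sum_nat_const; apply: leq_sum.
  cardlia.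
have dis : (M :\: S2) :&: Z' = set0.
  by apply/setP => x; rewrite !inE; case: [exists v in S1, _]; rewrite ?orbT ?andbF.
have sub : #|(M :\: S2) :|: Z'| <= #|out_nbh (adj X) S|.
  apply/subset_leq_card/subsetP => x; rewrite !inE.
  case/orP=> [/andP[xS2 /exists_inP[v vS1 vx]]|/andP[]].
    apply/andP; split; last first.
      by apply/exists_inP; exists v => //; move: vS1; rewrite inE => /andP[].
    apply: contra xS2 => xS; rewrite xS andbT; apply/negP => xL.
    by apply: (low_degree_independent (S1L _ vS1) (v := x)); rewrite ?inE // (adjS XG vx).
  rewrite negb_or => /andP[-> _] /exists_inP[u uS2 ux]; apply/exists_inP; exists u => //.
  by move: uS2; rewrite inE => /andP[].
have c1 := cardsID S2 M; have c2 : #|M :&: S2| <= #|S2| by apply/subset_leq_card/subsetIr.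
have c3 := cardsID low_degree S; rewrite -/S1 -/S2 in c3.
rewrite cardsU dis cards0 in sub.
cardlia.
Qed.

End Expansion.

(** * Resilience of typical graphs *)

Section Typical.
Variables (n m s0 : nat) (G1 G2 : graph n).
Let G : graph n := G1 :|: G2.
Implicit Types (H X F : graph n) (S T W A : {set 'I_n}).

(** The thresholds match what the deletion can destroy: [m] edges at a vertex, m|S| edges of a cut
    at [S], and mn/2 edges in total. A vertex of degree at least [m + 20] keeps 20 edges; [21 * n]
    makes room for 20 chosen edges at each vertex and for [n] added boosters. *)
Record typical : Prop := Typical {
  typical_min_degree : forall v, 1 < degree G v;
  typical_low_vertex : exists v, degree G v <= m;
  typical_low_sparse : forall W A, A \subset W -> A != set0 -> #|W| <= 5 ->
    A \subset low_degree G (m + 20) -> #|edges_in G W| + #|A| <= #|W|;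
  typical_sparse : forall W, 0 < #|W| <= 4 * s0 -> #|edges_in G W| < 2 * #|W|;
  typical_cut : forall S T, s0 < #|S| -> 5 * #|S| <= n -> #|T| <= 2 * #|S| ->
    m * #|S| < #|G1 :&: edge_cut S (~: (S :|: T))|;
  typical_boosters : forall F1 F2 : graph n, F1 \subset G1 -> F2 \subset G2 ->
    #|F2| <= 21 * n -> n ^ 2 <= 50 * #|boosters (F1 :|: F2)| ->
    m * n < 2 * #|G2 :&: boosters (F1 :|: F2)| }.

Hypotheses (n25 : 25 <= n) (typ : typical).

(** * Hamiltonicity after deleting a graph of small maximum degree *)

Section Deletion.
Variable H : graph n.
Hypothesis Hm : max_degree H <= m.
Hypothesis degGH : forall v, 1 < degree (G :\: H : graph n) v.
Let G' : graph n := G :\: H.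

Let degH v : degree H v <= m.
Proof. exact: leq_trans (leq_degree_max H v) Hm. Qed.

Let K v : graph n := odflt set0 [pick B : graph n |
  (B \subset [set e in G' | v \in val e]) && (#|B| == minn 20 (degree G' v))].

Let KP v : (K v \subset [set e in G' | v \in val e]) /\ #|K v| = minn 20 (degree G' v).
Proof.
rewrite /K; case: pickP => [B /andP[? /eqP]|nB] //=.
have /set0Pn[B] : [set B : graph n | B \subset [set e in G' | v \in val e]
    & #|B| == minn 20 (degree G' v)] != set0.
  by rewrite -card_gt0 cards_draws bin_gt0 geq_minr.
by rewrite inE nB.
Qed.

Let X0 : graph n := (G1 :\: H) :|: \bigcup_v K v.

Let X0G' : X0 \subset G'.
Proof.
rewrite subUset; apply/andP; split; first by rewrite setSD // subsetUl.
by apply/bigcupsP => v _; apply: subset_trans (KP v).1 _; apply/subsetP => e; rewrite inE => /andP[].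
Qed.

Let X0_deg v : minn 20 (degree G' v) <= degree X0 v.
Proof.
have [Ks <-] := KP v; apply/subset_leq_card/subsetP => e eK.
have := subsetP Ks _ eK; rewrite !inE => /andP[_ ->]; rewrite andbT.
by apply/orP; right; apply/bigcupP; exists v.
Qed.

Let X0_extra : #|X0 :\: G1| <= 20 * n.
Proof.
apply: leq_trans (_ : #|\bigcup_v K v| <= _).
  apply/subset_leq_card/subsetP => e; rewrite !inE => /andP[eG1].
  by rewrite (negPf eG1) andbF.
apply: leq_trans (_ : \sum_(v < n) #|K v| <= _).
  by elim/big_ind2: _ => [|A a B b Aa Bb|//]; rewrite ?cards0 // (leq_trans (leq_card_setU _ _)) ?leq_add.
rewrite mulnC -[n in leqRHS]card_ord -sum_nat_const; apply: leq_sum => v _.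
by rewrite (KP v).2 geq_minl.
Qed.

Let X0_expander : expander (n %/ 5) X0.
Proof.
move=> S Sn; have {}Sn : 5 * #|S| <= n.
  by rewrite mulnC; apply: leq_trans (leq_trunc_div n 5); rewrite leq_mul2r Sn.
have [Ss0|Ss0] := leqP #|S| s0.
  apply: (small_expansion (typical_low_sparse typ) _ _ _ (typical_sparse typ)) => //.
  - exact: subset_trans X0G' (subsetDl _ _).
  - move=> v; apply: leq_trans (X0_deg v); rewrite leq_min /=.
    exact: degGH.
  - move=> v; rewrite inE -leqNgt => vD; apply: leq_trans (X0_deg v).
    rewrite leq_min /=; have := degreeD G H v; have := degH v.
    rewrite -/G'; lia.
rewrite leqNgt; apply/negP => Nlt.
(* Here [T] is the outer neighbourhood of [S] in [X0]. No edge of [X0] joins [S] to the complement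
   of [S] and [T], so the red edges of this cut all lie in [H], which has at most m|S| edges at
   [S]. *)
have := typical_cut typ Ss0 Sn (ltnW Nlt); rewrite ltnNge => /negP; apply.
set U := ~: _.
apply: leq_trans (_ : #|H :&: edge_cut S U| <= _).
  apply/subset_leq_card/subsetP => e; rewrite inE => /andP[eG1 eU].
  rewrite inE eU andbT; apply: contraLR eU => eH.
  rewrite inE; apply/exists_inP => -[u uS /exists_inP[v vU /eqP euv]].
  move: vU; rewrite !inE; apply/negP; rewrite negbK.
  case: (v \in S) => //=; apply/exists_inP; exists u => //.
  by apply/exists_inP; exists e; rewrite ?euv // !inE eH eG1.
apply: leq_trans (card_cut_degree _ _ _) _.
by rewrite mulnC -sum_nat_const; apply: leq_sum.
Qed.

Let card_H : 2 * #|H| <= m * n.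
Proof.
rewrite -sum_degree mulnC -[n in leqRHS]card_ord -sum_nat_const.
exact: leq_sum.
Qed.

(** [d] bounds the number of vertices missed by a longest path. As [H] has at most mn/2 edges, some
    blue booster survives; adding it either gives a Hamiltonian graph or lowers [d] by one, so the
    number of edges outside [G1] plus [d] does not grow. At [d = 0] only the first outcome is
    possible. *)
Let add_boosters d X : X0 \subset X -> X \subset G' ->
  n <= longest_path X + d -> #|X :\: G1| + d <= 21 * n -> hamiltonian G'.
Proof.
elim: d X => [|d IH] X X0X XG' ld ed;
  (have [hX|hX] := boolP (hamiltonian X); first exact: hamiltonianS hX).
all: have k6 : n < 6 * (n %/ 5) by lia.
all: have k0 : 0 < n %/ 5 by lia.
all: have := card_boosters k0 k6 (leq_trans (isT : 2 < 25) n25) (expanderS X0X X0_expander) hX.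
all: have XE : X = (X :&: G1) :|: (X :\: G1) by rewrite setID.
all: move=> cb; have := @typical_boosters typ (X :&: G1) (X :\: G1) (subsetIr _ _).
all: rewrite -XE => /(_ _)/(_ _)/(_ _) tb.
all: have {tb} : m * n < 2 * #|G2 :&: boosters X|.
1,3: apply: tb.
1,4: by apply/subsetP => e; rewrite inE => /andP[eG1 /(subsetP XG')]; rewrite !inE (negPf eG1) => /andP[_].
1,3: by apply: leq_trans ed; rewrite leq_addr.
1,2: have k5 : n < 5 * (n %/ 5).+1 by lia.
1,2: by nia.
all: move=> tb; have /subsetPn[f] : ~~ (G2 :&: boosters X \subset H).
1,3: by apply/negP => /subset_leq_card; lia.
all: rewrite !inE => /andP[fG2 /andP[fX fb]] fH.
all: have fXG' : (f |: X : graph n) \subset G' by rewrite subUset XG' sub1set !inE fH fG2 orbT.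
all: case/orP: fb => [hf|lf]; first exact: hamiltonianS hf.
all: have [t [Ut _ tl]] := longest_pathP (f |: X : graph n).
all: have := uniq_size_ord Ut; rewrite tl => ln.
  by have := leq_trans lf ln; rewrite ltnNge -(addn0 (longest_path X)) ld.
apply: (IH (f |: X)) => //.
- exact: subset_trans X0X (subsetUr _ _).
- by apply: leq_trans ld _; rewrite addnS -addSn leq_add2r.
- apply: leq_trans ed; rewrite addnS -addSn leq_add2r.
  rewrite setDUl; apply: leq_trans (leq_card_setU _ _) _.
  by rewrite -add1n leq_add2r; apply: leq_trans (subset_leq_card (subsetDl _ _)) _; rewrite cards1.
Qed.

Lemma typical_hamiltonian : hamiltonian G'.
Proof.
apply: (add_boosters (d := n) (subxx _) X0G'); first exact: leq_addl.
by have := X0_extra; lia.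
Qed.

End Deletion.

Lemma typical_resilience :
  (local_resilience (@hamiltonian n) G).+1 = min_degree G.
Proof.
have n0 : 0 < n by lia.
have [[v dv] lb] := min_degreeP G n0.
have [[H [HG nH rE]] rlb] := local_resilience_hamP G.
have [w dw] := typical_low_vertex typ.
have d2 : 1 < min_degree G by rewrite dv; exact: (typical_min_degree typ).
apply/eqP; rewrite eqn_leq; apply/andP; split.
- have /card_gt0P[e0 e0P] : 0 < #|[set e in G | v \in val e]|.
    by rewrite -/(degree G v) -dv ltnW.
  move: e0P; rewrite inE => /andP[e0G ve0].
  pose S : graph n := [set e in G | v \in val e] :\ e0.
  have cS : #|S|.+1 = min_degree G.
    rewrite dv; have := cardsD1 e0 [set e in G | v \in val e].
    by rewrite [_ \in _]inE e0G ve0 add1n => <-.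
  rewrite -cS ltnS; apply: leq_trans (rlb S _ _) _.
  + by apply/subsetP => e; rewrite !inE => /and3P[].
  + apply/negP => /(hamiltonian_degree v); rewrite ltnNge => /negP; apply.
    rewrite -(cards1 e0); apply/subset_leq_card/subsetP => e; rewrite !inE.
    by case: (e == e0) => //= /andP[/andP[nS eG] ve]; rewrite eG ve in nS.
  + apply/bigmax_leqP => u _; apply/subset_leq_card/subsetP => e.
    by rewrite inE => /andP[].
- rewrite leqNgt; apply/negP => rlt; apply/negP: nH.
  have rm : (max_degree H).+2 <= min_degree G.
    by move: rlt; rewrite -rE.
  rewrite negbK; apply: typical_hamiltonian.
    by have := lb w; lia.
  move=> u; have := degreeD G H u; have := leq_degree_max H u; have := lb u; lia.
Qed.

End Typical.

From mathcomp Require Import all_order all_algebra ring lra.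
From mathcomp Require Import reals sequences exp.
Import Order.TTheory GRing.Theory Num.Theory.
Local Open Scope ring_scope.

(** * Finite product measures *)

Section ProductMeasure.
Variables (R : realType) (E S : finType) (mu : S -> R).
Hypotheses (mu_ge0 : forall s, 0 <= mu s) (mu_sum : \sum_s mu s = 1).
Implicit Types (w : {ffun E -> S}) (f g : {ffun E -> S} -> R).
Implicit Types (A B : pred {ffun E -> S}).

Definition expect f : R := \sum_(w : {ffun E -> S}) (\prod_e mu (w e)) * f w.
Definition prob A : R := expect (fun w => (A w)%:R).

Lemma expect_prod (g : E -> S -> R) :
  expect (fun w => \prod_e g e (w e)) = \prod_e \sum_s mu s * g e s.
Proof. by rewrite bigA_distr_bigA; apply: eq_bigr => w _; rewrite -big_split. Qed.

Lemma le_expect f g : (forall w, f w <= g w) -> expect f <= expect g.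
Proof.
by move=> fg; apply: ler_sum => w _; rewrite ler_wpM2l // prodr_ge0.
Qed.

Lemma expect_sum (I : finType) (P : pred I) (f : I -> {ffun E -> S} -> R) :
  expect (fun w => \sum_(i | P i) f i w) = \sum_(i | P i) expect (f i).
Proof.
by rewrite /expect; under eq_bigr do rewrite mulr_sumr; rewrite exchange_big.
Qed.

Lemma expectZ c f : expect (fun w => c * f w) = c * expect f.
Proof. by rewrite /expect mulr_sumr; apply: eq_bigr => w _; rewrite mulrCA. Qed.

Lemma expectD f g : expect (fun w => f w + g w) = expect f + expect g.
Proof. by rewrite /expect -big_split; apply: eq_bigr => w _; rewrite mulrDr. Qed.

Lemma expect1 : expect (fun=> 1) = 1.
Proof.
transitivity (expect (fun w => \prod_(e : E) 1)).
  by apply: eq_bigr => w _; rewrite [X in _ = _ * X]big1.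
by rewrite (expect_prod (fun _ _ => 1)) big1 // => e _; under eq_bigr do rewrite mulr1.
Qed.

Lemma prob_ge0 A : 0 <= prob A.
Proof. by apply: sumr_ge0 => w _; rewrite mulr_ge0 // prodr_ge0. Qed.

Lemma probC A : prob (predC A) = 1 - prob A.
Proof.
suff <- : prob (predC A) + prob A = 1 by rewrite addrK.
rewrite -expectD -[RHS]expect1; apply: eq_bigr => w _ /=.
by case: (A w); rewrite /= ?addr0 ?add0r.
Qed.

Lemma le_prob A B : (forall w, A w -> B w) -> prob A <= prob B.
Proof.
by move=> AB; apply: le_expect => w; rewrite ler_nat; case: (A w) (AB w) => // ->.
Qed.

Lemma prob_union (I : finType) (P : pred I) A (B : I -> pred {ffun E -> S}) :
  (forall w, A w -> exists2 i, P i & B i w) ->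
  prob A <= \sum_(i | P i) prob (B i).
Proof.
move=> AB; rewrite -expect_sum; apply: le_expect => w.
case Aw : (A w); last by apply: sumr_ge0.
have [i Pi Bi] := AB _ Aw; rewrite (bigD1 i) //= Bi lerDl.
exact: sumr_ge0.
Qed.

Lemma prob_orb A B : prob (fun w => A w || B w) <= prob A + prob B.
Proof.
rewrite -expectD; apply: le_expect => w.
by case: (A w); case: (B w); rewrite /= ?addr0 ?add0r ?lerDl.
Qed.

(** The exponential moment method in product form: the indicator of [A] is at most the product
    divided by [c], and the expectation of a product over independent coordinates factorises. The
    tail bounds below for fixed sets amount to a choice of [g]. *)
Lemma prob_markov A (g : E -> S -> R) (c : R) : 0 < c ->
  (forall e s, 0 <= g e s) ->
  (forall w, A w -> c <= \prod_e g e (w e)) ->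
  prob A <= c^-1 * \prod_e \sum_s mu s * g e s.
Proof.
move=> c0 g0 Ac; rewrite -expect_prod -expectZ; apply: le_expect => w.
have gw : 0 <= \prod_e g e (w e) by rewrite prodr_ge0.
case Aw : (A w); last by rewrite mulr_ge0 // invr_ge0 ltW.
by rewrite mulrC ler_pdivlMr // mul1r Ac.
Qed.

End ProductMeasure.

(** * Two-coloured binomial random graphs *)

Section Coloured.
Variables (R : realType) (n : nat).
Implicit Types (w : {ffun edge n -> option bool}) (p : R).

(** A single experiment with three outcomes per pair makes the colour classes disjoint and their
    union distributed exactly as G(n, p). *)
Definition colour_weight p (s : option bool) : R :=
  match s with None => 1 - p | Some true => p / 50 | Some false => 49 / 50 * p end.

Definition red w : graph n := [set e | w e == Some true].
Definition blue w : graph n := [set e | w e == Some false].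
Definition coloured w : graph n := red w :|: blue w.

Definition cprob p := @prob R (edge n) (option bool) (colour_weight p).

Lemma in_coloured w e : (e \in coloured w) = (w e != None).
Proof. by rewrite !inE; case: (w e) => [[]|]. Qed.

Lemma colour_weight_ge0 p : 0 <= p <= 1 -> forall s, 0 <= colour_weight p s.
Proof. by move=> /andP[p0 p1] [[]|] /=; lra. Qed.

Lemma big_option_bool (F : option bool -> R) :
  \sum_s F s = F None + F (Some true) + F (Some false).
Proof.
rewrite (bigD1 None) //= (bigD1 (Some true)) //= (bigD1 (Some false)) //= big1 ?addr0 ?addrA //.
by case=> [[]|].
Qed.

Lemma colour_weight_sum p : \sum_s colour_weight p s = 1.
Proof. by rewrite big_option_bool /=; field. Qed.

Lemma Gnp_prob_coloured p (A : pred (graph n)) :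
  Gnp_prob p A = cprob p (fun w => A (coloured w)).
Proof.
rewrite /cprob /prob.
transitivity (expect (colour_weight p) (fun w => \sum_(G : graph n | A G) (coloured w == G)%:R)); last first.
  apply: eq_bigr => w _; congr (_ * _).
  rewrite big_mkcond (bigD1 (coloured w)) //= eqxx big1 ?addr0; first by case: (A _).
  by move=> G /negPf GE; rewrite eq_sym GE if_same.
rewrite expect_sum /Gnp_prob; apply: eq_bigr => G _.
transitivity (expect (colour_weight p)
   (fun w => \prod_e ((w e != None) == (e \in G))%:R)); last first.
  apply: eq_bigr => w _; congr (_ * _).
  have [<-|wG] := eqVneq (coloured w) G.
    by rewrite big1 // => e _; rewrite in_coloured eqxx.
  have /existsP[e eG] : [exists e, (e \in coloured w) != (e \in G)].
    apply: contraT; rewrite negb_exists => /forallP H; case/eqP: wG.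
    by apply/setP => e; have := H e; rewrite negbK => /eqP.
  by rewrite (bigD1 e) //= -in_coloured (negPf eG) mul0r.
rewrite (expect_prod _ (fun e s => ((s != None) == (e \in G))%:R)); apply: eq_bigr => e _; rewrite big_option_bool /=.
by case: (e \in G) => /=; field.
Qed.

Lemma prod_le_expR (I : finType) (P : pred I) (F H : I -> R) :
  (forall i, P i -> 0 <= F i <= expR (H i)) ->
  \prod_(i | P i) F i <= expR (\sum_(i | P i) H i).
Proof. by move=> FH; rewrite expR_sum; apply: ler_prod => i /FH. Qed.

Lemma chernoff_coloured p (A : pred {ffun edge n -> option bool}) (y : edge n -> R) c :
  0 <= p <= 1 -> 0 < c -> (forall e, 0 <= y e) ->
  (forall w, A w -> c <= \prod_(e in coloured w) y e) ->
  cprob p A <= c^-1 * expR (\sum_e (y e - 1) * p).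
Proof.
move=> p01 c0 y0 Ac.
apply: le_trans (prob_markov (colour_weight_ge0 p01) (g := fun e s => if s == None then 1 else y e) c0 _ _) _.
- by move=> e s; case: ifP.
- move=> w /Ac/le_trans; apply; rewrite big_mkcond; apply: ler_prod => e _.
  by rewrite in_coloured; case: (w e == None); rewrite /= ?ler01 ?y0 lexx.
rewrite ler_wpM2l ?invr_ge0 ?(ltW c0) //; apply: prod_le_expR => e _.
rewrite big_option_bool /=; have := y0 e; case/andP: p01 => p0 p1 ye.
apply/andP; split; last by apply: le_trans (expR_ge1Dx _); lra.
by rewrite !addr_ge0 ?mulr_ge0 ?subr_ge0 //; lra.
Qed.

Lemma chernoff_red p (A : pred {ffun edge n -> option bool}) (y : edge n -> R) c :
  0 <= p <= 1 -> 0 < c -> (forall e, 0 <= y e) ->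
  (forall w, A w -> c <= \prod_(e in red w) y e) ->
  cprob p A <= c^-1 * expR (\sum_e (y e - 1) * (p / 50)).
Proof.
move=> p01 c0 y0 Ac.
apply: le_trans (prob_markov (colour_weight_ge0 p01) (g := fun e s => if s == Some true then y e else 1) c0 _ _) _.
- by move=> e s; case: ifP.
- move=> w /Ac/le_trans; apply; rewrite big_mkcond; apply: ler_prod => e _.
  by rewrite inE; case: (w e == _); rewrite /= ?ler01 ?y0 lexx.
rewrite ler_wpM2l ?invr_ge0 ?(ltW c0) //; apply: prod_le_expR => e _.
rewrite big_option_bool /=; have := y0 e; case/andP: p01 => p0 p1 ye.
apply/andP; split; last by apply: le_trans (expR_ge1Dx _); lra.
by rewrite !addr_ge0 ?mulr_ge0 ?subr_ge0 //; lra.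
Qed.

End Coloured.

(** * Counting and numerical estimates *)

Section Counting.
Variable n : nat.
Implicit Types (S U W : {set 'I_n}).

Lemma card_star (v : 'I_n) : #|[set e : edge n | v \in val e]| = n.-1.
Proof.
have -> : [set e : edge n | v \in val e] = [set e in [set: edge n] | v \in val e].
  by apply/setP => e; rewrite !inE.
rewrite -/(degree _ v) degreeE.
have -> : nbrs [set: edge n] v = [set~ v].
  apply/setP => u; rewrite !inE; have [->|uv] := eqVneq u v.
    by rewrite (contraTF (@adj_neq _ _ _ _)) ?eqxx.
  by rewrite adj_sym (adjE _ uv) inE.
by rewrite cardsC1 card_ord.
Qed.

Lemma card_pairs W : #|[set e : edge n | val e \subset W]| = 'C(#|W|, 2).
Proof.
rewrite -cards_draws -(card_imset _ val_inj); apply: eq_card => B.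
rewrite !inE; apply/imsetP/andP => [[e]|[BW B2]].
  by rewrite inE => eW ->; split=> //; exact: (valP e).
by exists (exist (fun e : {set 'I_n} => is_true (#|e| == 2)) B B2); rewrite ?inE.
Qed.

Lemma card_edge : #|edge n| = 'C(n, 2).
Proof.
have := card_pairs [set: 'I_n]; rewrite cardsT card_ord => <-.
by rewrite -cardsT; apply: eq_card => e; rewrite !inE subsetT.
Qed.

Lemma card_cut S U : [disjoint S & U] -> (#|S| * #|U| <= #|edge_cut S U|)%N.
Proof.
move=> dis; rewrite -cardsX.
have inj : {in setX S U &, injective (fun uv => [set uv.1; uv.2])}.
  move=> [u v] [u' v']; rewrite !inE /= => /andP[uS vU] /andP[u'S v'U] E.
  have nSU a : a \in S -> a \in U -> False.
    by move=> aS aU; move: dis; rewrite disjoint_subset => /subsetP/(_ _ aS); rewrite inE aU.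
  have uu : u = u'.
    have : u \in [set u'; v'] by rewrite -E !inE eqxx.
    by rewrite !inE => /orP[/eqP//|/eqP uv']; case: (nSU u) => //; rewrite uv'.
  have vv : v = v'.
    have : v \in [set u'; v'] by rewrite -E !inE eqxx orbT.
    by rewrite !inE => /orP[/eqP vu'|/eqP//]; case: (nSU v) => //; rewrite vu'.
  by rewrite uu vv.
rewrite -(card_in_imset inj) -(card_imset (mem (edge_cut S U)) val_inj).
apply/subset_leq_card/subsetP => B /imsetP[[u v]]; rewrite !inE /= => /andP[uS vU] ->.
have uv : u != v.
  apply: contraTneq uS => ->; move: dis; rewrite disjoint_sym disjoint_subset.
  by move=> /subsetP/(_ _ vU).
apply/imsetP; exists (mkedge uv) => //; rewrite inE.
by apply/exists_inP; exists u => //; apply/exists_inP; exists v.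
Qed.

End Counting.

Section Numeric.
Variable R : realType.
Implicit Types (x y : R).

Let sqr_lb b x : 0 <= b -> b <= x -> b ^+ 2 <= x ^+ 2.
Proof. by move=> b0 bx; rewrite lerXn2r ?nnegrE // (le_trans b0). Qed.

Let inv_ub b x : 0 < b -> b <= x -> x^-1 <= b^-1.
Proof. by move=> b0 bx; rewrite lef_pV2 ?posrE // (lt_le_trans b0). Qed.

(** Rational bounds for exponentials come from 1 + x <= e^x at a small argument, followed by
    repeated squaring with rounded intermediate values. *)
Lemma expR_half_ge : 13 / 8 <= expR (1 / 2 : R).
Proof.
have h0 : 33 / 32 <= expR (1 / 32 : R) by apply: le_trans (expR_ge1Dx _); lra.
have -> : (1 / 2 : R) = 1 / 32 * 16%:R by lra.
rewrite expRM_natr (_ : 16 = 2 * 2 * 2 * 2)%N // !exprM.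
set a := expR _ in h0 *.
have h1 : 1063 / 1000 <= a ^+ 2 by apply: le_trans (sqr_lb _ h0); lra.
have h2 : 11299 / 10000 <= (a ^+ 2) ^+ 2 by apply: le_trans (sqr_lb _ h1); lra.
have h3 : 1276 / 1000 <= ((a ^+ 2) ^+ 2) ^+ 2 by apply: le_trans (sqr_lb _ h2); lra.
by apply: le_trans (sqr_lb _ h3); lra.
Qed.

Lemma expRN2_le : expR (- 2 : R) <= 144 / 1000.
Proof.
have : 1000 / 144 <= expR (2 : R); last first.
  by rewrite expRN => h; apply: le_trans (inv_ub _ h) _; lra.
have -> : (2 : R) = 1 / 2 * 4%:R by lra.
have := expR_half_ge.
rewrite expRM_natr (exprM _ 2 2) => h.
have h1 : 264 / 100 <= expR (1 / 2 : R) ^+ 2 by apply: le_trans (sqr_lb _ h); lra.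
by apply: le_trans (sqr_lb _ h1); lra.
Qed.

Lemma expRNhalf_le : expR (- (1 / 2) : R) <= 8 / 13.
Proof.
by rewrite expRN; apply: le_trans (inv_ub _ expR_half_ge) _; lra.
Qed.

Lemma expR1_le : expR (1 : R) <= 3.
Proof.
have h0 : expR (1 / 8 : R) <= 8 / 7.
  have : 7 / 8 <= expR (- (1 / 8) : R) by apply: le_trans (expR_ge1Dx _); lra.
  by rewrite expRN => h; rewrite -[leLHS]invrK; apply: le_trans (inv_ub _ h) _; lra.
have -> : (1 : R) = 1 / 8 * 8%:R by lra.
rewrite expRM_natr (_ : 8 = 2 * 2 * 2)%N // !exprM.
have a0 := expR_ge0 (1 / 8 : R); set a := expR _ in h0 a0 *.
have h1 : a ^+ 2 <= 131 / 100 by apply: le_trans (sqr_lb _ h0) _; lra.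
have h2 : (a ^+ 2) ^+ 2 <= 173 / 100 by apply: le_trans (sqr_lb _ h1) _; rewrite ?sqr_ge0 //; lra.
by apply: le_trans (sqr_lb _ h2) _; rewrite ?sqr_ge0 //; lra.
Qed.

Lemma sum_set_expr (T : finType) x :
  \sum_(W : {set T}) x ^+ #|W| = (1 + x) ^+ #|T|.
Proof.
transitivity (\prod_(i : T) (x + 1)); last by rewrite prodr_const addrC.
rewrite bigA_distr; apply: eq_bigr => W _.
by rewrite -big_mkcond /= prodr_const.
Qed.

Lemma sum_set_expr_le (T : finType) x : 0 <= x ->
  \sum_(W : {set T}) x ^+ #|W| <= expR (x * #|T|%:R).
Proof.
move=> x0; rewrite sum_set_expr expRM_natr lerXn2r ?nnegrE ?expR_ge0 ?expR_ge1Dx //.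
by rewrite addr_ge0.
Qed.

(** Each counted set has weight at least x^k in [sum_set_expr_le]. For x = k/|T| this is the
    familiar bound (e|T|/k)^k; [x] stays free because one value will serve for two different [k]. *)
Lemma card_le_sets (T : finType) k x : 0 < x <= 1 ->
  #|[set W : {set T} | (#|W| <= k)%N]|%:R <= x ^- k * expR (x * #|T|%:R).
Proof.
case/andP=> x0 x1; rewrite mulrC ler_pdivlMr ?exprn_gt0 //.
apply: le_trans (sum_set_expr_le _ (ltW x0)).
rewrite [leRHS](bigID (fun W : {set T} => (#|W| <= k)%N)) /=.
rewrite -sum1_card natr_sum big_distrl /=.
rewrite -[leLHS]addr0; apply: lerD; last by apply: sumr_ge0 => W _; rewrite exprn_ge0 // ltW.
rewrite (eq_bigl (fun W : {set T} => (#|W| <= k)%N)); last by move=> W; rewrite inE.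
by apply: ler_sum => W Wk; rewrite mul1r ler_wiXn2l // ltW.
Qed.

Lemma geometric_le x k : 0 <= x <= 1 / 2 -> \sum_(1 <= i < k) x ^+ i <= 2 * x.
Proof.
case/andP=> x0 x2; case: k => [|k]; first by rewrite big_geq // mulr_ge0.
suff : \sum_(1 <= i < k.+1) x ^+ i <= 2 * x - 2 * (x ^+ k * x).
  by move/le_trans; apply; rewrite lerBlDr lerDl !mulr_ge0 ?exprn_ge0.
elim: k => [|k IH]; first by rewrite big_geq // expr0; lra.
rewrite big_nat_recr //= exprS; set a := x ^+ k in IH *.
have a0 : 0 <= a by rewrite exprn_ge0.
have : 0 <= x * a * (1 - 2 * x) by rewrite !mulr_ge0 //; lra.
move: IH; set b := \sum_(_ <= _ < _) _; nra.
Qed.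

End Numeric.

(** * Probabilities of atypical configurations *)

Section Weights.
Variable R : realType.

Lemma prod_weight (E : finType) (X Y : {set E}) (a : R) :
  \prod_(e in X) (if e \in Y then a else 1) = a ^+ #|X :&: Y|.
Proof.
rewrite -big_mkcondr /= (eq_bigl (mem (X :&: Y))) ?prodr_const // => e.
by rewrite !inE.
Qed.

Lemma sum_weight (E : finType) (Y : {set E}) (a q : R) :
  \sum_e ((if e \in Y then a else 1) - 1) * q = (a - 1) * #|Y|%:R * q.
Proof.
rewrite -mulr_suml; congr (_ * _).
rewrite (bigID (mem Y)) /= [X in _ + X]big1 => [|e /negPf->]; last by rewrite subrr.
rewrite addr0 (eq_bigr (fun=> a - 1)) => [|e ->//].
by rewrite sumr_const mulr_natr.
Qed.

Lemma sum_weight2 (E : finType) (Y Z : {set E}) (a b q : R) : [disjoint Y & Z] ->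
  \sum_e ((if e \in Y then a else 1) * (if e \in Z then b else 1) - 1) * q =
  ((a - 1) * #|Y|%:R + (b - 1) * #|Z|%:R) * q.
Proof.
move=> dis; rewrite mulrDl -!sum_weight -big_split /=; apply: eq_bigr => e _.
case: ifP => eY; case: ifP => eZ; try by field.
by move: dis; rewrite disjoint_subset => /subsetP/(_ _ eY); rewrite inE eZ.
Qed.

(** Grouping by size leaves a geometric series. The hypothesis counts the sets of size at most |W|,
    rather than exactly |W|, to match [card_le_sets]. *)
Lemma sum_sets_geometric (T : finType) (P : pred {set T}) (F : {set T} -> R) rho :
  0 <= rho <= 1 / 2 -> (forall W, P W -> 0 < #|W|)%N ->
  (forall W, P W -> 
     #|[set V : {set T} | (#|V| <= #|W|)%N]|%:R * F W <= rho ^+ #|W|) ->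
  \sum_(W | P W) F W <= 2 * rho.
Proof.
move=> rho2 P0 PF; have rho0 : 0 <= rho by case/andP: rho2.
pose N t := #|[set V : {set T} | (#|V| <= t)%N]|%:R : R.
have N1 t : 0 < N t.
  by rewrite ltr0n; apply/card_gt0P; exists set0; rewrite inE cards0.
apply: le_trans (_ : \sum_(W : {set T} | (0 < #|W|)%N) rho ^+ #|W| / N #|W| <= _).
  rewrite [leRHS]big_mkcond [leLHS]big_mkcond; apply: ler_sum => W _.
  case: ifP => [PW|_]; last by case: ifP => // _; rewrite divr_ge0 ?exprn_ge0 ?(ltW (N1 _)).
  by rewrite P0 // ler_pdivlMr // mulrC PF.
apply: le_trans (geometric_le #|T|.+1 rho2).
rewrite (partition_big (fun W : {set T} => inord #|W| : 'I_#|T|.+1) (fun t => 0 < t)%N) /=; last first.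
  by move=> W; rewrite inordK // ltnS max_card.
apply: le_trans (_ : \sum_(t < #|T|.+1 | (0 < t)%N) rho ^+ t <= _); last first.
  rewrite -(big_mkord (fun t => 0 < t)%N (fun t => rho ^+ t)) big_ltn_cond //=.
  rewrite big_nat_cond [leRHS]big_nat_cond.
  rewrite (eq_bigl (fun t => (0 < t < #|T|.+1)%N && true)) // => t.
  by case: (0 < t)%N; rewrite ?andbF ?andbT.
apply: ler_sum => t t0.
apply: le_trans (_ : \sum_(W : {set T} | (#|W| <= t)%N) rho ^+ t / N t <= _).
  rewrite [leRHS]big_mkcond [leLHS]big_mkcond; apply: ler_sum => W _.
  have NN : 0 <= rho ^+ t / N t by rewrite divr_ge0 ?exprn_ge0 ?(ltW (N1 _)).
  case: ifP => [/andP[_ /eqP Wt]|_]; last by case: ifP.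
  have <- : #|W| = t by rewrite -Wt inordK // ltnS max_card.
  by rewrite leqnn.
rewrite sumr_const -mulr_natl (_ : _%:R = N t); last first.
  by congr (_%:R); apply: eq_card => W; rewrite !inE.
by rewrite mulrCA divff ?mulr1 // gt_eqF // N1.
Qed.

End Weights.

Section Bounds.
Variables (R : realType) (n : nat) (p : R).
Hypothesis p01 : 0 <= p <= 1.
Implicit Types (G : graph n) (W A S T : {set 'I_n}).

Let p0 : 0 <= p. Proof. by case/andP: p01. Qed.
Let p1 : p <= 1. Proof. by case/andP: p01. Qed.
Let cw0 := colour_weight_ge0 p01.

(** The event is split according to the vertex and the only present pair at it, [None] meaning that
    there is none. The remaining n - 2 or n - 1 pairs at the vertex are absent, and both cases share
    one exponential bound. *)
Lemma prob_low_degree : (1 < n)%N ->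
  cprob p (fun w : {ffun edge n -> option bool} => [exists v, (degree (coloured w) v <= 1)%N])
  <= n%:R * (1 + n%:R * p) * expR (- (p * (n%:R - 2))).
Proof.
move=> n1.
pose B (i : 'I_n * option (edge n)) (w : {ffun edge n -> option bool}) :=
  [forall e : edge n, (i.1 \in val e) ==> (if Some e == i.2 then w e != None else w e == None)].
pose P (i : 'I_n * option (edge n)) := if i.2 is Some e then i.1 \in val e else true.
apply: le_trans (prob_union (P := P) (B := B) cw0 _) _.
  move=> w /existsP[v]; rewrite leq_eqVlt => /orP[/cards1P[e eE]|].
    exists (v, Some e).
      by have := set11 e; rewrite -[in X in X -> _]eE inE => /andP[].
    apply/forallP => f; apply/implyP => vf /=.
    have := in_set1 f e; rewrite -eE inE vf andbT in_coloured => fE.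
    have -> : (Some f == Some e) = (f == e) by [].
    by rewrite -fE; case: (w f == None).
  rewrite ltnS leqn0 cards_eq0 => /eqP E; exists (v, None) => //.
  apply/forallP => f; apply/implyP => vf /=.
  have := in_set0 f; rewrite -E inE vf andbT in_coloured.
  by case: (w f == None).
pose x := expR (- (p * (n%:R - 2))).
have q1 : 0 <= 1 - p by rewrite subr_ge0.
have le_x k : (n <= k + 2)%N -> (1 - p) ^+ k <= x.
  move=> nk; apply: le_trans (_ : expR (- p) ^+ k <= _).
    rewrite lerXn2r ?nnegrE ?expR_ge0 //.
    by apply: le_trans (expR_ge1Dx _).
  rewrite -expRM_natr /x ler_expR mulNr lerN2 ler_wpM2l //.
  by rewrite lerBlDr -natrD ler_nat.
have PB i : P i -> prob (colour_weight p) (B i) <= (if i.2 is Some e then p else 1) * x.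
  move=> Pi; pose g (e : edge n) (s : option bool) : R :=
    if i.1 \in val e then (if Some e == i.2 then s != None else s == None)%:R else 1.
  apply: le_trans (prob_markov (g := g) cw0 ltr01 _ _) _.
  - by move=> e s; rewrite /g; case: ifP.
  - move=> w /forallP Bw; rewrite big1 // => e _; rewrite /g.
    by case: ifP => // ie; have := Bw e; rewrite ie /= => ->.
  rewrite invr1 mul1r.
  rewrite (bigID (fun e : edge n => i.1 \in val e)) /= [X in _ * X]big1 ?mulr1; last first.
    by move=> e /negPf ie; rewrite /g ie; under eq_bigr do rewrite mulr1; rewrite colour_weight_sum.
  have gE (e : edge n) : i.1 \in val e -> \sum_s colour_weight p s * g e s =
      if Some e == i.2 then p else 1 - p.
    by move=> ie; rewrite big_option_bool /g ie /=; case: ifP => _ /=; field.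
  rewrite (eq_bigr _ gE); case: i Pi {gE g} => v [f|] /= vf; last first.
    rewrite mul1r (eq_bigr (fun=> 1 - p)) // (eq_bigl (mem [set e : edge n | v \in val e])); last first.
      by move=> e; rewrite !inE.
    by rewrite prodr_const card_star le_x //; lia.
  rewrite (bigD1 f) //= eqxx ler_wpM2l //.
  rewrite (eq_bigr (fun=> 1 - p)); last first.
    move=> e /andP[_ ef]; have -> : (Some e == Some f) = (e == f) by [].
    by rewrite (negPf ef).
  rewrite (eq_bigl (mem ([set e : edge n | v \in val e] :\ f))); last first.
    by move=> e; rewrite !inE andbC.
  rewrite prodr_const le_x //.
  by have := cardsD1 f [set e : edge n | v \in val e]; rewrite card_star inE (vf : v \in val f); lia.
apply: le_trans (ler_sum _ PB) _; rewrite -mulr_suml ler_wpM2r ?expR_ge0 //.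
rewrite -(pair_big_dep xpredT (fun v o => P (v, o)) (fun v o => if o is Some e then p else 1)) /=.
apply: le_trans (_ : \sum_(v < n) (1 + n%:R * p) <= _); last first.
  by rewrite sumr_const card_ord -[leLHS]mulr_natl.
apply: ler_sum => v _; rewrite (bigD1 None) //= lerD2l.
rewrite (eq_bigr (fun=> p)); last by case.
rewrite sumr_const -[leLHS]mulr_natl ler_wpM2r // ler_nat.
apply: leq_trans (_ : #|[set Some e | e in [set e : edge n | v \in val e]]| <= _)%N.
  apply/subset_leq_card/subsetP => -[e|//]; rewrite unfold_in /= => /andP[ve _].
  by apply/imsetP; exists e; rewrite ?inE.
by apply: leq_trans (leq_imset_card _ _) _; rewrite card_star leq_pred.
Qed.

End Bounds.

Section Bounds.
Variables (R : realType) (n : nat) (p : R).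
Hypothesis p01 : 0 < p <= 1.
Implicit Types (G : graph n) (W A S T : {set 'I_n}).
Implicit Types (w : {ffun edge n -> option bool}).

Let p0 : 0 < p. Proof. by case/andP: p01. Qed.
Let p1 : p <= 1. Proof. by case/andP: p01. Qed.
Let p01' : 0 <= p <= 1. Proof. by rewrite ltW. Qed.

Let pairs W : graph n := [set e : edge n | val e \subset W].

Let edges_inE G W : edges_in G W = G :&: pairs W.
Proof. by apply/setP => e; rewrite !inE. Qed.

(** Pairs inside [W] get the weight 1/p, which rewards the surplus of edges; pairs from [A] to the
    complement of [W] get e^(-2), which rewards their scarcity. The at most 10 pairs of the first
    kind contribute e^10, and 856/1000 is 1 - 0.144 with 0.144 >= e^(-2). *)
Lemma prob_low_dense_pair W A D : A \subset W -> (#|W| <= 5)%N ->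
  cprob p (fun w => (A \subset low_degree (coloured w) D) &&
                    (#|W| < #|edges_in (coloured w) W| + #|A|)%N) <=
  p ^+ (#|W| - #|A|).+1 *
  expR (10 + #|A|%:R * (2 * D%:R - 856 / 1000 * (p * (n%:R - 5)))).
Proof.
move=> AW W5.
have AW' := subset_leq_card AW.
set Y := pairs W; set Z := edge_cut A (~: W).
have dis : [disjoint Y & Z].
  rewrite disjoint_subset; apply/subsetP => e; rewrite !inE => eW.
  apply/exists_inP => -[u uA /exists_inP[v vW /eqP euv]].
  move: vW; rewrite inE => /negP; apply; apply: (subsetP eW).
  by rewrite euv !inE eqxx orbT.
pose z : R := expR (- 2).
have z0 : 0 < z by apply: expR_gt0.
have zle : z <= 144 / 1000 by apply: expRN2_le.
have z1 : z <= 1 by lra.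
have c0 : 0 < p^-1 ^+ (#|W| - #|A|).+1 * z ^+ (#|A| * D).
  by rewrite mulr_gt0 ?exprn_gt0 ?invr_gt0.
apply: le_trans (chernoff_coloured
   (y := fun e => (if e \in Y then p^-1 else 1) * (if e \in Z then z else 1))
   p01' c0 _ _) _.
- by move=> e; rewrite mulr_ge0 //; case: ifP => // _; rewrite ?invr_ge0 ltW.
- move=> w /andP[AL We]; rewrite big_split /= !prod_weight.
  apply: ler_pM; rewrite ?exprn_ge0 ?invr_ge0 ?(ltW z0) ?(ltW p0) //.
    by rewrite ler_weXn2l ?invf_ge1 // -edges_inE; rewrite ltn_subLR // addnC.
  rewrite ler_wiXn2l ?(ltW z0) //.
  apply: leq_trans (card_cut_degree _ _ _) _.
  rewrite -sum_nat_const; apply: leq_sum => a aA.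
  by have := subsetP AL _ aA; rewrite inE; apply: ltnW.
rewrite invfM -exprVn invrK -[leLHS]mulrA ler_wpM2l ?exprn_ge0 ?(ltW p0) //.
rewrite -exprVn /z -expRN opprK -expRM_natr -expRD ler_expR sum_weight2 //.
have cY : #|Y|%:R <= 10 :> R.
  rewrite (ler_nat _ _ 10) card_pairs.
  by apply: leq_trans (leq_bin2l 2 W5) _.
have cZ : #|A|%:R * (n%:R - 5) <= #|Z|%:R :> R.
  apply: le_trans (_ : (#|A| * #|~: W|)%N%:R <= _); last first.
    rewrite ler_nat card_cut // disjoint_subset; apply/subsetP => a aA.
    by rewrite !inE negbK (subsetP AW).
  rewrite natrM ler_wpM2l // lerBlDr -natrD ler_nat.
  apply: leq_trans (_ : #|W| + #|~: W| <= _)%N; first by rewrite cardsC card_ord.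
  by rewrite addnC leq_add2l.
have E : (p^-1 - 1) * #|Y|%:R * p <= 10.
  rewrite mulrAC mulrBl mulVf ?gt_eqF // mul1r.
  have : 0 <= #|Y|%:R :> R by []. 
  by move: cY; have := p0; have := p1; nra.
have F : (z - 1) * #|Z|%:R * p <= - (856 / 1000 * (#|A|%:R * (n%:R - 5)) * p).
  rewrite -mulNr ler_wpM2r ?(ltW p0) //.
  have : 0 <= #|Z|%:R :> R by [].
  by move: cZ zle; nra.
rewrite natrM mulrDl; move: E F; rewrite /z; nra.
Qed.

Lemma prob_dense W (y : R) : 1 <= y ->
  cprob p (fun w => (2 * #|W| <= #|edges_in (coloured w) W|)%N) <=
  y ^- (2 * #|W|) * expR (y * p * #|W|%:R ^+ 2 / 2).
Proof.
move=> y1; have y0 : 0 < y by lra.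
have c0 : 0 < y ^+ (2 * #|W|) by rewrite exprn_gt0.
apply: le_trans (chernoff_coloured
   (y := fun e => if e \in pairs W then y else 1) p01' c0 _ _) _.
- by move=> e; case: ifP => // _; rewrite ltW.
- by move=> w Ww; rewrite prod_weight -edges_inE ler_weXn2l.
rewrite ler_wpM2l ?invr_ge0 ?(ltW c0) // ler_expR sum_weight card_pairs.
have cb : 'C(#|W|, 2)%:R <= #|W|%:R ^+ 2 / 2 :> R.
  rewrite ler_pdivlMr // -natrX -natrM ler_nat bin2 muln2.
  apply: leq_trans (_ : #|W| * #|W|.-1 <= _)%N.
    by rewrite -[leqRHS]odd_double_half leq_addl.
  by rewrite -mulnn leq_mul2l leq_pred orbT.
apply: le_trans (_ : y * 'C(#|W|, 2)%:R * p <= _).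
  rewrite ler_wpM2r ?(ltW p0) // ler_wpM2r //; lra.
rewrite mulrAC -[leRHS]mulrA ler_wpM2l // mulr_ge0 ?ltW //.
Qed.

(** Pairs of the cut get the weight e^(-1/2) <= 8/13. As [S] and [T] cover at most 3n/5 vertices,
    the cut has at least |S| times 2n/5 pairs, and 325 arises from 5/13 * 2/5 * 1/50 = 1/325. *)
Lemma prob_sparse_cut S T m : (5 * #|S| <= n)%N -> (#|T| <= 2 * #|S|)%N ->
  cprob p (fun w => (#|red w :&: edge_cut S (~: (S :|: T))| <= m * #|S|)%N) <=
  expR (#|S|%:R * (m%:R / 2 - p * n%:R / 325)).
Proof.
move=> S5 T2; set U := ~: _; set Y := edge_cut S U.
pose z : R := expR (- (1 / 2)).
have z0 : 0 < z by apply: expR_gt0.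
have zle : z <= 8 / 13 by apply: expRNhalf_le.
have c0 : 0 < z ^+ (m * #|S|) by rewrite exprn_gt0.
apply: le_trans (chernoff_red
   (y := fun e => if e \in Y then z else 1) p01' c0 _ _) _.
- by move=> e; case: ifP => // _; rewrite ltW.
- by move=> w Ww; rewrite prod_weight ler_wiXn2l ?(ltW z0) //; lra.
rewrite -exprVn /z -expRN opprK -expRM_natr -expRD ler_expR sum_weight.
have cU : 2 / 5 * n%:R <= #|U|%:R :> R.
  have : (n <= #|U| + 3 * #|S|)%N.
    have := cardsC (S :|: T); rewrite card_ord -/U; have := leq_of_leqif (leq_card_setU S T); cardlia.
  by rewrite -(ler_nat R) natrD natrM; move: S5; rewrite -(ler_nat R) natrM; lra.
have cY : #|S|%:R * (2 / 5 * n%:R) <= #|Y|%:R :> R.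
  apply: le_trans (_ : (#|S| * #|U|)%N%:R <= _); first by rewrite natrM ler_wpM2l.
  rewrite ler_nat card_cut // disjoint_subset; apply/subsetP => a aS.
  by rewrite !inE aS.
have F : (z - 1) * #|Y|%:R * (p / 50) <= - (5 / 13 * (#|S|%:R * (2 / 5 * n%:R)) * (p / 50)).
  rewrite -mulNr ler_wpM2r ?divr_ge0 ?(ltW p0) //.
  have : 0 <= #|Y|%:R :> R by [].
  by move: cY zle; nra.
rewrite natrM; move: F; rewrite /z; nra.
Qed.

(** [F1], [F2] and [B] are disjoint, so prescribing the colours on [F1] and [F2] leaves the pairs of
    [B] untouched. Blue pairs of [B] get the weight e^(-2), and 49/50 of 0.856 exceeds 83/100. *)
Lemma prob_few_boosters (F1 F2 B : graph n) m :
  [disjoint F1 & F2] -> [disjoint F1 :|: F2 & B] ->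
  cprob p (fun w => [&& F1 \subset red w, F2 \subset blue w &
                     (2 * #|blue w :&: B| <= m * n)%N]) <=
  (p / 50) ^+ #|F1| * p ^+ #|F2| *
  expR ((m * n)%N%:R - 83 / 100 * (p * #|B|%:R)).
Proof.
move=> d12 dB.
pose z : R := expR (- 2).
have z0 : 0 < z by apply: expR_gt0.
have zle : z <= 144 / 1000 by apply: expRN2_le.
pose g (e : edge n) (s : option bool) : R :=
  if e \in F1 then (s == Some true)%:R else
  if e \in F2 then (s == Some false)%:R else
  if (e \in B) && (s == Some false) then z else 1.
have dis (X Y : graph n) e : [disjoint X & Y] -> e \in X -> (e \in Y) = false.
  by rewrite disjoint_subset => /subsetP d /d; rewrite inE => /negPf.
apply: le_trans (prob_markov (g := g) (colour_weight_ge0 p01') (expR_gt0 (- (m * n)%N%:R)) _ _) _.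
- by move=> e s; rewrite /g; do 3 (case: ifP => // _); rewrite ltW.
- move=> w /and3P[/subsetP F1w /subsetP F2w Bw].
  rewrite (eq_bigr (fun e => if e \in blue w :&: B then z else 1)); last first.
    move=> e _; rewrite /g.
    have -> : (e \in blue w :&: B) = (e \in B) && (w e == Some false) by rewrite !inE andbC.
    case: ifP => [eF1|_].
      have -> : (e \in B) = false by apply: dis dB _; rewrite inE eF1.
      by have := F1w _ eF1; rewrite inE => ->.
    case: ifP => [eF2|_ //].
    have -> : (e \in B) = false by apply: dis dB _; rewrite inE eF2 orbT.
    by have := F2w _ eF2; rewrite inE => ->.
  rewrite -big_mkcond prodr_const /z -expRM_natr ler_expR mulNr lerN2.
  by rewrite -natrM ler_nat.
rewrite -expRN opprK mulrC.
have gE e : \sum_s colour_weight p s * g e s <=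
    (if e \in F1 then p / 50 else 1) * (if e \in F2 then p else 1) *
    (if e \in B then expR (- (83 / 100 * p)) else 1).
  rewrite big_option_bool /g /=; have := p0; have := p1 => ? ?.
  case: ifP => [eF1|nF1].
    have -> : (e \in B) = false by apply: dis dB _; rewrite inE eF1.
    by rewrite (dis _ _ _ d12 eF1) !mulr0 !mulr1; lra.
  case: ifP => [eF2|nF2].
    have -> : (e \in B) = false by apply: dis dB _; rewrite inE eF2 orbT.
    by rewrite !mulr0 !mulr1; lra.
  case: (e \in B) => /=; last by lra.
  rewrite !mul1r; apply: le_trans (expR_ge1Dx _); nra.
apply: le_trans (_ : \prod_e ((if e \in F1 then p / 50 else 1) * (if e \in F2 then p else 1) *
    (if e \in B then expR (- (83 / 100 * p)) else 1)) * expR (m * n)%:R <= _).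
  rewrite ler_wpM2r ?expR_ge0 //; apply: ler_prod => e _; rewrite gE andbT.
  apply: sumr_ge0 => s _; rewrite mulr_ge0 ?colour_weight_ge0 //.
  by rewrite /g; do 3 (case: ifP => // _); rewrite ltW.
rewrite !big_split /= -!big_mkcond !prodr_const -expRM_natr -[leLHS]mulrA -expRD.
by rewrite mulNr mulrA addrC.
Qed.

End Bounds.

(** * Union bounds over vertex sets and over subgraphs *)

Section UnionBounds.
Variables (R : realType) (n : nat) (p L : R) (m s0 : nat).
Implicit Types (W A S T : {set 'I_n}).
Implicit Types (w : {ffun edge n -> option bool}).

Definition has_low_dense w := [exists W : {set 'I_n}, exists A : {set 'I_n},
  [&& A \subset W, A != set0, #|W| <= 5, A \subset low_degree (coloured w) (m + 20)
    & #|W| < #|edges_in (coloured w) W| + #|A|]]%N.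

Definition has_dense w := [exists W : {set 'I_n},
  [&& 0 < #|W|, #|W| <= 4 * s0 & 2 * #|W| <= #|edges_in (coloured w) W|]]%N.

Definition has_sparse_cut w := [exists S : {set 'I_n}, exists T : {set 'I_n},
  [&& s0 < #|S|, 5 * #|S| <= n, #|T| <= 2 * #|S|
    & #|red w :&: edge_cut S (~: (S :|: T))| <= m * #|S|]]%N.

Definition has_few_boosters w := [exists F1 : graph n, exists F2 : graph n,
  [&& F1 \subset red w, F2 \subset blue w, #|F2| <= 21 * n,
      n ^ 2 <= 50 * #|boosters (F1 :|: F2)|
    & 2 * #|blue w :&: boosters (F1 :|: F2)| <= m * n]]%N.

Hypotheses (nE : n%:R = expR L) (L4 : 4 <= L) (p0 : 0 < p) (p1 : p <= 1 / 100).
Hypotheses (np_ge : L <= n%:R * p) (np_le : n%:R * p <= 102 / 100 * L).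
Hypothesis m_le : m%:R <= L / 200.

Let p01 : 0 < p <= 1. Proof. by move: p0 p1 => ? ?; apply/andP; split; lra. Qed.
Let p01' : 0 <= p <= 1. Proof. by move: p0 p1 => ? ?; apply/andP; split; lra. Qed.
Let cw0 := colour_weight_ge0 p01'.
Let n0 : 0 < n%:R :> R. Proof. by rewrite nE expR_gt0. Qed.
Let L0 : 0 < L. Proof. by move: L4 => ?; lra. Qed.

(** For |W| = k and |A| = r the bound for one pair of sets is, up to constants and powers of L,
    n^-(k-r+1) times n^(-0.844r). This is at most n^(-k) times n^(-0.22), as r <= 5. Each [W] has at
    most 32 subsets, and the sum of n^(-|W|) over all [W] is at most e. *)
Lemma prob_has_low_dense : (m + 20)%:R <= 6 / 1000 * L ->
  cprob p has_low_dense <= 32 * (2 * L) ^+ 5 * expR (16 - 22 / 100 * L).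
Proof.
have [hL4 hnp hnp' hm] := And4 L4 np_ge np_le m_le.
have hp1 := p1.
move=> Dle; pose P (i : {set 'I_n} * {set 'I_n}) :=
  [&& i.2 \subset i.1, i.2 != set0 & #|i.1| <= 5]%N.
apply: le_trans (prob_union (P := P) (B := fun i w =>
  (i.2 \subset low_degree (coloured w) (m + 20)) &&
  (#|i.1| < #|edges_in (coloured w) i.1| + #|i.2|)%N) cw0 _) _.
  move=> w /existsP[W /existsP[A /and5P[? ? ? ? ?]]].
  by exists (W, A); [apply/and3P | apply/andP].
set c := (2 * L) ^+ 5 * expR (15 - 22 / 100 * L).
have c0 : 0 <= c by rewrite mulr_ge0 ?exprn_ge0 ?expR_ge0 //; lra.
have bnd i : P i -> prob (colour_weight p) (fun w : {ffun edge n -> option bool} =>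
    (i.2 \subset low_degree (coloured w) (m + 20)) &&
    (#|i.1| < #|edges_in (coloured w) i.1| + #|i.2|)%N) <= c * (n%:R^-1) ^+ #|i.1|.
  case: i => W A /and3P[/= AW A0 W5].
  apply: le_trans (prob_low_dense_pair p01 (m + 20) AW W5) _.
  have AW' := subset_leq_card AW.
  have A1 : (0 < #|A|)%N by rewrite card_gt0.
  move: AW' A1 W5; move: (#|W|) (#|A|) => k r rk r0 k5.
  have e5 : ((k - r).+1 <= 5)%N.
    by rewrite ltn_subLR // (leq_ltn_trans k5) // -[X in (X < _)%N]add0n ltn_add2r.
  have r5' : (r <= 5)%N := leq_trans rk k5.
  have nV : n%:R^-1 = expR (- L) by rewrite nE expRN.
  have ple : p <= 2 * L * expR (- L).
    rewrite -nV ler_pdivlMr // mulrC; lra.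
  have plek : p ^+ (k - r).+1 <= (2 * L * expR (- L)) ^+ (k - r).+1.
    by rewrite lerXn2r ?nnegrE ?(ltW p0) // (le_trans (ltW p0) ple).
  apply: le_trans (ler_wpM2r (expR_ge0 _) plek) _.
  rewrite exprMn /c nV -!expRM_natr -[leLHS]mulrA -[leRHS]mulrA -!expRD.
  apply: ler_pM; rewrite ?exprn_ge0 ?expR_ge0 //; first by lra.
    by apply: ler_weXn2l e5; lra.
  rewrite ler_expR.
  have -> : (k - r).+1%:R = k%:R - r%:R + 1 :> R by rewrite -natr1 natrB.
  have r1 : 1 <= r%:R :> R by rewrite ler1n.
  have r5 : r%:R <= 5 :> R by rewrite (ler_nat _ r 5).
  (* Here 0.844 is 0.856 minus twice 0.006, and the 1 absorbs the 5 vertices missing from [n]. *)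
  have e1 : 2 * (m + 20)%:R - 856 / 1000 * (p * (n%:R - 5)) <= - (844 / 1000) * L + 1.
    by move: np_ge p1 Dle; nra.
  have e2 : r%:R * (2 * (m + 20)%:R - 856 / 1000 * (p * (n%:R - 5))) <=
            r%:R * (- (844 / 1000) * L + 1) by rewrite ler_wpM2l //; lra.
  move: e2; set a := r%:R * _ => e2.
  have e3 : r%:R * L <= 5 * L by rewrite ler_wpM2r // ltW.
  by move: e2 e3 r1 r5 L4; lra.
apply: le_trans (ler_sum _ bnd) _.
rewrite (eq_bigl (fun i : {set 'I_n} * {set 'I_n} => (#|i.1| <= 5)%N && ((i.2 \subset i.1) && (i.2 != set0)))); last first.
  by move=> [W A]; rewrite /P /= andbA andbC.
rewrite -(pair_big_dep (fun W => #|W| <= 5)%N (fun W A => (A \subset W) && (A != set0))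
   (fun W A => c * n%:R^-1 ^+ #|W|)) /=.
apply: le_trans (_ : \sum_(W : {set 'I_n}) 32 * c * n%:R^-1 ^+ #|W| <= _).
  rewrite big_mkcond; apply: ler_sum => W _.
  have t0 : 0 <= c * n%:R^-1 ^+ #|W| by rewrite mulr_ge0 ?exprn_ge0 ?invr_ge0 ?ler0n.
  case: ifP => [W5|_]; last by rewrite -mulrA mulr_ge0.
  rewrite sumr_const -[leLHS]mulr_natl -[leRHS]mulrA ler_wpM2r // ler_nat.
  apply: leq_trans (_ : #|powerset W| <= _)%N.
    by apply/subset_leq_card/subsetP => A; rewrite unfold_in inE => /andP[].
  by rewrite card_powerset (leq_pexp2l (m := 2) (n2 := 5)).
have nV0 : 0 <= n%:R^-1 :> R by rewrite invr_ge0 ler0n.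
have := sum_set_expr_le 'I_n nV0; rewrite card_ord mulVf ?gt_eqF // => sW.
rewrite -mulr_sumr; apply: le_trans (ler_wpM2l _ sW) _; first by rewrite mulr_ge0.
have -> : 16 - 22 / 100 * L = 15 - 22 / 100 * L + 1 by lra.
by rewrite expRD /c !mulrA.
Qed.

(** For |W| = t, the number of sets times the bound for one of them is at most (27/16 (np)^2 t/n)^t,
    using e <= 3. Since t <= 4n/L^4, the base is at most 8/L^2. *)
Lemma prob_has_dense : s0%:R * L ^+ 4 <= n%:R ->
  cprob p has_dense <= 16 / L ^+ 2.
Proof.
have [hL4 hnp hnp' hm] := And4 L4 np_ge np_le m_le.
have hp1 := p1.
move=> s0L.
apply: le_trans (prob_union (P := fun W => (0 < #|W| <= 4 * s0)%N)
  (B := fun W w => (2 * #|W| <= #|edges_in (coloured w) W|)%N) cw0 _) _.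
  by move=> w /existsP[W /and3P[? ? ?]]; exists W => //; apply/andP.
have -> : 16 / L ^+ 2 = 2 * (8 / L ^+ 2) by field; lra.
have L2 : 16 <= L ^+ 2 by rewrite expr2; nra.
apply: sum_sets_geometric.
- rewrite divr_ge0 ?exprn_ge0 ?(ltW L0) //= ler_pdivrMr ?exprn_gt0 //; lra.
- by move=> W /andP[].
move=> W /andP[W0 Ws].
have t0 : 0 < #|W|%:R :> R by rewrite ltr0n.
have tn : #|W|%:R <= n%:R :> R by rewrite ler_nat -[n in (_ <= n)%N]card_ord max_card.
have tL : #|W|%:R * L ^+ 4 <= 4 * n%:R.
  have : #|W|%:R <= 4 * s0%:R :> R by rewrite -natrM ler_nat.
  by move: s0L; have := exprn_ge0 4 (ltW L0); nra.
have L44 : L ^+ 4 = L ^+ 2 * L ^+ 2 by rewrite -exprD.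
have pt : p * #|W|%:R <= 4.
  have : p * #|W|%:R * (n%:R * L ^+ 4) <= 4 * (n%:R * L ^+ 4).
    apply: le_trans (_ : (102 / 100 * L) * (4 * n%:R) <= _).
      rewrite (_ : p * _ * _ = (n%:R * p) * (#|W|%:R * L ^+ 4)); last by ring.
      by rewrite ler_pM ?mulr_ge0 ?exprn_ge0 ?(ltW L0) ?(ltW p0).
    rewrite (_ : 102 / 100 * L * (4 * n%:R) = 4 * (n%:R * (102 / 100 * L))); last by ring.
    rewrite ler_wpM2l // ler_wpM2l // L44; nra.
  by rewrite ler_pM2r // mulr_gt0 ?exprn_gt0.
(* With t = |W|, this value of [y] minimises the bound y^(-2t) e^(y p t^2/2) of [prob_dense]. *)
have y1 : 1 <= 4 / (p * #|W|%:R) by rewrite ler_pdivlMr ?mulr_gt0 // mul1r.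
apply: le_trans (ler_wpM2l (ler0n _ _) (prob_dense p01 W y1)) _.
have x01 : 0 < (#|W|%:R / n%:R : R) <= 1 by rewrite divr_gt0 //= ler_pdivrMr // mul1r.
have := @card_le_sets R 'I_n #|W| _ x01; rewrite card_ord => cW.
apply: le_trans (ler_wpM2r _ cW) _.
  by rewrite mulr_ge0 ?expR_ge0 ?invr_ge0 ?exprn_ge0 //; lra.
move: cW y1 pt tL tn t0 x01 {W0 Ws}; move: (#|W|) => t _ y1 pt tL tn t0 _.
rewrite divfK ?gt_eqF // -exprVn invf_div -[(4 / _) ^- _]exprVn invf_div exprM.
have -> : 4 / (p * t%:R) * p * t%:R ^+ 2 / 2 = 2 * t%:R :> R by field; rewrite !gt_eqF.
rewrite -[in expR t%:R](mul1r t%:R) !expRM_natr -!exprMn.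
apply: lerXn2r; rewrite ?nnegrE.
- by rewrite mulr_ge0 ?(mulr_ge0 _ (expR_ge0 _)) ?sqr_ge0 ?divr_ge0 ?(ltW t0).
- by rewrite divr_ge0 ?sqr_ge0.
- apply: le_trans (_ : n%:R / t%:R * 3 * ((p * t%:R / 4) ^+ 2 * 3 ^+ 2) <= _).
    rewrite (_ : expR 2 = expR 1 ^+ 2); last by rewrite -expRM_natr mul1r.
    have e3 := expR1_le R; have e0 := expR_ge0 (1 : R).
    apply: ler_pM.
    - by rewrite mulr_ge0 ?divr_ge0 ?(ltW t0).
    - by rewrite mulr_ge0 ?sqr_ge0.
    - by rewrite ler_wpM2l ?divr_ge0 ?(ltW t0).
    - by rewrite ler_wpM2l ?sqr_ge0 // lerXn2r ?nnegrE.
  rewrite ler_pdivlMr ?exprn_gt0 //.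
  have -> : n%:R / t%:R * 3 * ((p * t%:R / 4) ^+ 2 * 3 ^+ 2) * L ^+ 2 =
      27 / 16 * ((n%:R * p) ^+ 2 * (t%:R * L ^+ 2 / n%:R)).
    by field; rewrite !gt_eqF.
  have a1 : (n%:R * p) ^+ 2 <= (102 / 100 * L) ^+ 2.
    apply: lerXn2r; rewrite ?nnegrE //; last by lra.
    by rewrite mulr_ge0 // ltW.
  have a2 : t%:R * L ^+ 2 / n%:R <= 4 / L ^+ 2.
    by rewrite ler_pdivrMr // mulrAC ler_pdivlMr ?exprn_gt0 // -mulrA -L44.
  apply: le_trans (_ : 27 / 16 * ((102 / 100 * L) ^+ 2 * (4 / L ^+ 2)) <= _).
    apply: ler_wpM2l; first by lra.
    have b1 : 0 <= (n%:R * p) ^+ 2 by apply: sqr_ge0.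
    have b2 : 0 <= t%:R * L ^+ 2 / n%:R by rewrite divr_ge0 // mulr_ge0 ?sqr_ge0.
    exact: ler_pM b1 b2 a1 a2.
  have -> : 27 / 16 * ((102 / 100 * L) ^+ 2 * (4 / L ^+ 2)) = 27 / 16 * (102 / 100) ^+ 2 * 4.
    by field; rewrite gt_eqF.
  by lra.
Qed.

(** For |S| = t > s0 the ratio n/t is at most L^4, so there are at most (e L^4)^t choices of [S] and
    (e L^8)^t choices of [T]. They are outweighed by the bound for one cut, because 1/325 - 1/400 >
    1/2000. *)
Lemma prob_has_sparse_cut : n%:R <= s0.+1%:R * L ^+ 4 ->
  L ^+ 12 * expR (2 - L / 2000) <= 1 / 2 ->
  cprob p has_sparse_cut <= 2 * (L ^+ 12 * expR (2 - L / 2000)).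
Proof.
have [hL4 hnp hnp' hm] := And4 L4 np_ge np_le m_le.
have hp1 := p1.
move=> s0L rho2; set rho := L ^+ 12 * _ in rho2 *.
have rho0 : 0 <= rho by rewrite mulr_ge0 ?exprn_ge0 ?expR_ge0 ?(ltW L0).
apply: le_trans (prob_union (P := fun i : {set 'I_n} * {set 'I_n} =>
    [&& s0 < #|i.1|, 5 * #|i.1| <= n & #|i.2| <= 2 * #|i.1|]%N)
  (B := fun i w => (#|red w :&: edge_cut i.1 (~: (i.1 :|: i.2))| <= m * #|i.1|)%N) cw0 _) _.
  by move=> w /existsP[S /existsP[T /and4P[? ? ? ?]]]; exists (S, T) => //; apply/and3P.
apply: le_trans (_ : \sum_(i : {set 'I_n} * {set 'I_n} |
    ((s0 < #|i.1|) && (5 * #|i.1| <= n) && (#|i.2| <= 2 * #|i.1|))%N)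
    expR (- (L / 2000)) ^+ #|i.1| <= _).
  rewrite (eq_bigl (fun i : {set 'I_n} * {set 'I_n} =>
    (s0 < #|i.1|) && (5 * #|i.1| <= n) && (#|i.2| <= 2 * #|i.1|))%N); last first.
    by move=> i; rewrite andbA.
  apply: ler_sum => -[S T] /andP[/andP[/= Ss S5] T2].
  apply: le_trans (prob_sparse_cut p01 m S5 T2) _.
  rewrite -expRM_natr ler_expR mulrC ler_wpM2r //.
  by move: np_ge m_le; rewrite [p * _]mulrC; lra.
rewrite -(pair_big_dep (fun S => (s0 < #|S|) && (5 * #|S| <= n))%N (fun S T => #|T| <= 2 * #|S|)%N
   (fun S T => expR (- (L / 2000)) ^+ #|S|)) /=.
apply: sum_sets_geometric => [|S|S]; first by rewrite rho0.
  by case/andP => /(leq_ltn_trans (leq0n _)).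
case/andP=> Ss S5.
have s1 : (0 < #|S|)%N by apply: leq_ltn_trans Ss.
have t0 : 0 < #|S|%:R :> R by rewrite ltr0n.
have sn : #|S|%:R <= n%:R :> R by rewrite ler_nat (leq_trans _ S5) // leq_pmull.
have x01 : 0 < (#|S|%:R / n%:R : R) <= 1 by rewrite divr_gt0 //= ler_pdivrMr // mul1r.
have := @card_le_sets R 'I_n #|S| _ x01; rewrite card_ord divfK ?gt_eqF // => c1.
have := @card_le_sets R 'I_n (2 * #|S|) _ x01; rewrite card_ord divfK ?gt_eqF // => c2.
rewrite sumr_const -[X in _ * X]mulr_natl mulrA.
rewrite [X in _ * X%:R](_ : _ = #|[set T : {set 'I_n} | (#|T| <= 2 * #|S|)%N]|); last first.
  by apply: eq_card => T; rewrite !inE.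
apply: le_trans (ler_wpM2r _ (ler_pM _ _ c1 c2)) _; rewrite ?exprn_ge0 ?expR_ge0 //.
have : n%:R / #|S|%:R <= L ^+ 4.
  rewrite ler_pdivrMr // mulrC; apply: le_trans s0L _.
  by rewrite ler_wpM2r ?exprn_ge0 ?(ltW L0) // ler_nat.
move: t0 {c1 c2 Ss S5 s1 sn x01}; move: (#|S|) => t t0 nt.
rewrite -!exprVn invf_div exprM /rho expRD (_ : L ^+ 12 = L ^+ 4 ^+ 3); last by rewrite -exprM.
have -> : expR t%:R = expR (1 : R) ^+ t by rewrite -expRM_natr mul1r.
rewrite -!exprMn lerXn2r ?nnegrE ?mulr_ge0 ?exprn_ge0 ?expR_ge0 ?invr_ge0 ?(ltW L0) ?(ltW t0) //.
have -> : expR 2 = expR (1 : R) ^+ 2 by rewrite -expRM_natr mul1r.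
set a := n%:R / t%:R; set b := expR 1; set d := expR (- _).
rewrite (_ : a * b * (a ^+ 2 * b) * d = a ^+ 3 * (b ^+ 2 * d)); last by ring.
rewrite ler_wpM2r ?mulr_ge0 ?sqr_ge0 ?expR_ge0 // lerXn2r ?nnegrE ?exprn_ge0 ?(ltW L0) //.
by rewrite divr_ge0 ?(ltW t0).
Qed.

(** In units of nL, the exponent collects 0.0102 from the sum over all red graphs, 0.005 from the
    factor e^(mn), and -0.83/50 = -0.0166 from the n^2/50 boosters; -0.0014 remains. The blue graphs
    add only n(1 + 21 ln L). *)
Lemma prob_has_few_boosters :
  cprob p has_few_boosters <= expR (n%:R * (1 + 21 * ln L - 14 / 10 / 1000 * L)).
Proof.
have [hL4 hnp hnp' hm] := And4 L4 np_ge np_le m_le.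
have hp1 := p1.
have aux (x y : R) : x <= 50 * y -> 83 / 100 / 50 * x <= 83 / 100 * y by lra.
pose B i : graph n := boosters (i.1 :|: i.2 : graph n).
apply: le_trans (prob_union (P := fun i : graph n * graph n =>
    [&& [disjoint i.1 & i.2], #|i.2| <= 21 * n & n ^ 2 <= 50 * #|B i|]%N)
  (B := fun i w => [&& i.1 \subset red w, i.2 \subset blue w &
                     (2 * #|blue w :&: B i| <= m * n)%N]) cw0 _) _.
  move=> w /existsP[F1 /existsP[F2 /and5P[F1w F2w ? ? ?]]]; exists (F1, F2); apply/and3P; split=> //=.
  rewrite disjoint_subset; apply/subsetP => e eF1; rewrite inE; apply/negP => eF2.
  by have := subsetP F1w _ eF1; have := subsetP F2w _ eF2; rewrite !inE => /eqP->.
(* Multiplication by la^(|F2| - 21n) >= 1 makes the restriction on |F2| dispensable: the sum over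
   all blue graphs is then e^(O(n)), at the price of a factor e^(21 n ln L). *)
pose la : R := L^-1.
have la0 : 0 < la by rewrite invr_gt0.
have la1 : la <= 1 by rewrite invf_le1 //; lra.
pose c : R := expR ((m * n)%N%:R - 83 / 100 / 50 * (p * n%:R ^+ 2)).
pose N : R := #|edge n|%:R.
have N_le : N <= n%:R ^+ 2 / 2.
  rewrite /N card_edge ler_pdivlMr // -natrX -natrM ler_nat bin2 muln2.
  apply: leq_trans (_ : n * n.-1 <= _)%N.
    by rewrite -[leqRHS]odd_double_half leq_addl.
  by rewrite -mulnn leq_mul2l leq_pred orbT.
apply: le_trans (_ : \sum_(i : graph n * graph n)
   (p / 50) ^+ #|i.1| * ((la * p) ^+ #|i.2| * (la ^- (21 * n) * c)) <= _).
  rewrite big_mkcond; apply: ler_sum => -[F1 F2] _ /=.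
  have nn : 0 <= (p / 50) ^+ #|F1| * ((la * p) ^+ #|F2| * (la ^- (21 * n) * c)).
    by rewrite !mulr_ge0 ?exprn_ge0 ?divr_ge0 ?mulr_ge0 ?invr_ge0 ?exprn_ge0 ?expR_ge0 ?(ltW p0) ?(ltW la0) ?(ltW L0).
  case: ifP => // /and3P[d12 F2n nB].
  apply: le_trans (prob_few_boosters (B := B (F1, F2)) p01 m d12 _) _.
    rewrite disjoint_subset; apply/subsetP => e eF; rewrite inE; apply/negP.
    by rewrite inE eF.
  move: (#|B (F1, F2)|) nB => b nB.
  rewrite -mulrA ler_wpM2l ?exprn_ge0 ?divr_ge0 ?(ltW p0) //.
  rewrite exprMn [leRHS]mulrACA -[leLHS]mul1r; apply: ler_pM => //.
    by rewrite mulr_ge0 ?exprn_ge0 ?expR_ge0 // ltW.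
    by rewrite ler_pdivlMr ?exprn_gt0 // mul1r ler_wiXn2l ?(ltW la0).
  rewrite ler_wpM2l ?exprn_ge0 ?(ltW p0) // /c ler_expR lerD2l lerN2.
  move: nB; rewrite -(ler_nat R) natrX natrM => nB.
  have : p * n%:R ^+ 2 <= p * (50 * b%:R) by rewrite ler_wpM2l ?(ltW p0).
  by move=> h; apply: aux; rewrite [leRHS]mulrCA.
rewrite -(pair_bigA _ (fun F1 F2 : graph n => (p / 50) ^+ #|F1| * ((la * p) ^+ #|F2| * (la ^- (21 * n) * c)))) /=.
under eq_bigr do rewrite -mulr_sumr -mulr_suml.
rewrite -mulr_suml.
apply: le_trans (_ : expR (p / 50 * N) * (expR (la * p * N) * (la ^- (21 * n) * c)) <= _).
  rewrite ler_pM //.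
  - by apply: sumr_ge0 => F _; rewrite exprn_ge0 // divr_ge0 ?(ltW p0).
  - rewrite mulr_ge0 ?mulr_ge0 ?invr_ge0 ?exprn_ge0 ?expR_ge0 ?(ltW la0) //.
    by apply: sumr_ge0 => F _; rewrite exprn_ge0 // mulr_ge0 ?(ltW p0) ?(ltW la0).
  - by apply: sum_set_expr_le; rewrite divr_ge0 ?(ltW p0).
  rewrite ler_wpM2r ?mulr_ge0 ?invr_ge0 ?exprn_ge0 ?expR_ge0 ?(ltW la0) //.
  by apply: sum_set_expr_le; rewrite mulr_ge0 ?(ltW p0) ?(ltW la0).
have -> : la ^- (21 * n) = expR (ln L * (21 * n)%:R).
  by rewrite -exprVn invrK expRM_natr lnK ?posrE.
rewrite /c -!expRD ler_expR !natrM.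
have n0' := ltW n0.
have e1 : p / 50 * N <= 102 / 100 / 100 * (n%:R * L).
  have : p * N <= n%:R * (102 / 100 * L) / 2.
    apply: le_trans (ler_wpM2l (ltW p0) N_le) _.
    rewrite (_ : p * (n%:R ^+ 2 / 2) = n%:R * (n%:R * p) / 2); last by ring.
    by have := ler_wpM2l (ltW n0) hnp'; lra.
  lra.
have e2 : la * p * N <= 51 / 100 * n%:R.
  have h : p * N <= 51 / 100 * n%:R * L.
    by move: e1; lra.
  rewrite -mulrA mulrC /la ler_pdivrMr //.
have e3 : m%:R * n%:R <= n%:R * L / 200.
  by have := ler_wpM2l (ltW n0) hm; lra.
have e4 : n%:R * L <= p * n%:R ^+ 2.
  rewrite (_ : p * n%:R ^+ 2 = n%:R * (n%:R * p)); last by ring.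
  by rewrite ler_wpM2l.
rewrite mulrBr mulrDr.
by move: e1 e2 e3 e4; lra.
Qed.

End UnionBounds.

(** * A vertex of low degree, by the second moment method *)

Section SecondMoment.
Variables (R : realType) (n : nat) (p : R) (m : nat).
Hypothesis p01 : 0 <= p <= 1.
Implicit Types (X Y J K : graph n) (e : edge n).
Implicit Types (w : {ffun edge n -> option bool}).

Let p0 : 0 <= p. Proof. by case/andP: p01. Qed.
Let q0 : 0 <= 1 - p. Proof. by rewrite subr_ge0; case/andP: p01. Qed.
Let cw0 := colour_weight_ge0 p01.

Definition few X w := (#|coloured w :&: X| <= m)%N.

(** For J within X, the product of these factors is the indicator that the coloured graph meets [X]
    exactly in [J]. Summed over small [J], it writes [few X] through products, whose expectations
    are explicit. *)
Let cyl J X e (s : option bool) : R :=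
  if e \in X then ((s != None) == (e \in J))%:R else 1.

Let sub_few X J := (J \subset X) && (#|J| <= m)%N.

Let fewE X w : (few X w)%:R = \sum_(J | sub_few X J) \prod_e cyl J X e (w e).
Proof.
have cylE J : J \subset X -> \prod_e cyl J X e (w e) = (J == coloured w :&: X)%:R.
  move=> JX; have [->|neq] := eqVneq J (coloured w :&: X).
    rewrite big1 // => e _; rewrite /cyl inE in_coloured; case: ifP => // eX.
    by rewrite eX andbT eqxx.
  have /existsP[e eJ] : [exists e, (e \in J) != (e \in coloured w :&: X)].
    apply: contraT; rewrite negb_exists => /forallP H; case/eqP: neq.
    by apply/setP => e; have := H e; rewrite negbK => /eqP.
  rewrite (bigD1 e) //= (_ : cyl _ _ _ _ = 0) ?mul0r //.
  move: eJ; rewrite inE in_coloured /cyl; case: ifP => eX; rewrite ?eX ?andbT ?andbF.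
    by rewrite eq_sym => /negPf->.
  by rewrite (contraFF (subsetP JX e) eX).
rewrite (eq_bigr (fun J => (J == coloured w :&: X)%:R)); last first.
  by move=> J /andP[/cylE].
rewrite big_mkcond (bigD1 (coloured w :&: X)) //= big1 ?addr0.
  by rewrite /sub_few subsetIr /= eqxx /few; case: leq.
by move=> J /negPf->; rewrite if_same.
Qed.

Let cyl_mean J X e : \sum_s colour_weight p s * cyl J X e s =
  if e \in X then (if e \in J then p else 1 - p) else 1.
Proof.
rewrite /cyl big_option_bool /=; case: ifP => _; last by field.
by case: ifP => _ /=; field.
Qed.

Let cyl_prod J X : J \subset X ->
  \prod_e (\sum_s colour_weight p s * cyl J X e s) = p ^+ #|J| * (1 - p) ^+ #|X :\: J|.
Proof.
move=> JX; under eq_bigr do rewrite cyl_mean.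
rewrite -big_mkcond (bigID (mem J)) /=; congr (_ * _).
  rewrite (eq_bigr (fun=> p)) => [|e /andP[_ ->]//].
  rewrite (eq_bigl (mem J)) ?prodr_const // => e /=.
  by case eJ: (e \in J); rewrite ?andbT ?andbF // (subsetP JX).
rewrite (eq_bigr (fun=> 1 - p)) => [|e /andP[_ /negPf->]//].
by rewrite (eq_bigl (mem (X :\: J))) ?prodr_const // => e; rewrite !inE andbC.
Qed.

Lemma prob_few X :
  cprob p (few X) = \sum_(J | sub_few X J) p ^+ #|J| * (1 - p) ^+ #|X :\: J|.
Proof.
transitivity (expect (colour_weight p)
    (fun w => \sum_(J | sub_few X J) \prod_e cyl J X e (w e))).
  by apply: eq_bigr => w _; rewrite fewE.
rewrite expect_sum; apply: eq_bigr => J /andP[JX _].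
by rewrite (expect_prod _ (cyl J X)) cyl_prod.
Qed.

Lemma prob_few_independent X Y : [disjoint X & Y] ->
  cprob p (fun w => few X w && few Y w) = cprob p (few X) * cprob p (few Y).
Proof.
move=> dis.
transitivity (expect (colour_weight p) (fun w => \sum_(J | sub_few X J) \sum_(K | sub_few Y K)
    \prod_e (cyl J X e (w e) * cyl K Y e (w e)))).
  apply: eq_bigr => w _; congr (_ * _); rewrite -mulnb natrM fewE fewE big_distrl /=.
  by apply: eq_bigr => J _; rewrite big_distrr /=; apply: eq_bigr => K _; rewrite big_split.
rewrite expect_sum !prob_few big_distrl /=; apply: eq_bigr => J /andP[JX _].
rewrite expect_sum big_distrr /=; apply: eq_bigr => K /andP[KY _].
rewrite (expect_prod _ (fun e s => cyl J X e s * cyl K Y e s)).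
rewrite -!cyl_prod // -big_split /=; apply: eq_bigr => e _.
have [eX|eX] := boolP (e \in X).
  have eY : (e \in Y) = false.
    by move: dis; rewrite disjoint_subset => /subsetP/(_ _ eX); rewrite inE => /negPf.
  rewrite [X in _ = _ * X]cyl_mean eY mulr1; apply: eq_bigr => s _.
  by rewrite {2}/cyl eY mulr1.
rewrite [X in _ = X * _]cyl_mean (negPf eX) mul1r; apply: eq_bigr => s _.
by rewrite {1}/cyl (negPf eX) mul1r.
Qed.

(** In the absence of [e], which has probability 1 - p and is independent of the other pairs, the
    events for [X] and for [X :\ e] coincide. *)
Lemma prob_few_remove X e : e \in X ->
  (1 - p) * cprob p (few (X :\ e)) <= cprob p (few X).
Proof.
move=> eX; rewrite !prob_few big_distrr /= [leRHS]big_mkcond [leLHS]big_mkcond.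
apply: ler_sum => J _; case: ifP => [/andP[]|_]; last first.
  by case: ifP => // _; rewrite mulr_ge0 ?exprn_ge0.
rewrite subsetD1 => /andP[JX eJ] Jm; rewrite /sub_few JX Jm /= mulrCA -exprS.
rewrite (_ : #|X :\: J| = #|(X :\ e) :\: J|.+1) //.
rewrite (cardsD1 e) !inE eJ eX add1n; congr _.+1; apply: eq_card => f.
by rewrite !inE andbCA.
Qed.

Lemma prob_few_ge X : (m <= #|X|)%N ->
  'C(#|X|, m)%:R * p ^+ m * (1 - p) ^+ #|X| <= cprob p (few X).
Proof.
move=> mX; rewrite prob_few.
apply: le_trans (_ : \sum_(J : graph n | (J \subset X) && (#|J| == m)) p ^+ #|J| * (1 - p) ^+ #|X :\: J| <= _); last first.
  rewrite [leLHS]big_mkcond [leRHS]big_mkcond; apply: ler_sum => J _.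
  case: ifP => [/andP[JX /eqP Jm]|_]; first by rewrite /sub_few JX Jm leqnn.
  by case: ifP => // _; rewrite mulr_ge0 ?exprn_ge0.
apply: le_trans (_ : \sum_(J : graph n | (J \subset X) && (#|J| == m)) p ^+ m * (1 - p) ^+ #|X| <= _).
  rewrite sumr_const -[leRHS]mulr_natl mulrA le_eqVlt; apply/orP; left; apply/eqP.
  congr (_%:R * _ * _); rewrite -cards_draws; apply: eq_card => J.
  by rewrite !inE.
apply: ler_sum => J /andP[JX /eqP ->]; rewrite ler_wpM2l ?exprn_ge0 //.
rewrite ler_wiXn2l //; first by rewrite lerBlDr lerDl.
exact/subset_leq_card/subsetDl.
Qed.

Let star (v : 'I_n) : graph n := [set e : edge n | v \in val e].

Let few_starE v w : few (star v) w = (degree (coloured w) v <= m)%N.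
Proof.
rewrite /few /degree; congr (_ <= _)%N; apply: eq_card => e.
by rewrite !inE.
Qed.

(** Chebyshev's inequality for the number of vertices of degree at most [m]. The stars of two
    vertices share a single pair; its removal makes the two events independent and costs a factor (1
    - p)^(-2). *)
Lemma prob_no_low_vertex : p < 1 ->
  let mu := \sum_v cprob p (few (star v)) in 0 < mu ->
  cprob p (fun w => [forall v, (m < degree (coloured w) v)%N]) <=
  mu^-1 + ((1 - p) ^- 2 - 1).
Proof.
move=> p1 mu mu0.
have q1 : 0 < 1 - p by rewrite subr_gt0.
pose a v := cprob p (few (star v)).
have muE : mu = \sum_v a v by [].
have a0 v : 0 <= a v by apply: (prob_ge0 cw0).
pose cnt w : R := \sum_v (few (star v) w)%:R.
have pair u v : cprob p (fun w => few (star u) w && few (star v) w) <=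
    (if u == v then a v else 0) + a u * a v * (1 - p) ^- 2.
  have nn : 0 <= a u * a v * (1 - p) ^- 2 by rewrite !mulr_ge0 ?invr_ge0 ?exprn_ge0.
  have [uv|uv] := eqVneq u v.
    rewrite uv in nn *; apply: le_trans (_ : a v <= _); last by rewrite lerDl.
    by apply: (le_prob cw0) => w /andP[].
  rewrite add0r; pose f := mkedge uv.
  have fu : f \in star u by rewrite inE /= !inE eqxx.
  have fv : f \in star v by rewrite inE /= !inE eqxx orbT.
  have dis : [disjoint star u :\ f & star v :\ f].
    rewrite -setI_eq0; apply/eqP/setP => e; rewrite !inE; apply/negP.
    case/andP=> /andP[ef ue] /andP[_ ve]; case/eqP: ef; apply: val_inj; apply/eqP.
    rewrite eq_sym eqEcard subUset !sub1set ue ve /= (eqP (valP e)) cards2.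
    by rewrite uv.
  apply: le_trans (_ : cprob p (fun w => few (star u :\ f) w && few (star v :\ f) w) <= _).
    apply: (le_prob cw0) => w /andP[fwu fwv]; apply/andP; split.
      by apply: leq_trans fwu; apply/subset_leq_card/setIS/subD1set.
    by apply: leq_trans fwv; apply/subset_leq_card/setIS/subD1set.
  rewrite prob_few_independent // ler_pdivlMr ?exprn_gt0 //.
  rewrite (_ : _ * _ * _ = ((1 - p) * cprob p (few (star u :\ f))) *
                           ((1 - p) * cprob p (few (star v :\ f)))); last by ring.
  by rewrite ler_pM ?mulr_ge0 ?(prob_ge0 cw0) ?prob_few_remove.
have E2 : expect (colour_weight p) (fun w => cnt w ^+ 2) <= mu + mu ^+ 2 * (1 - p) ^- 2.
  have -> : expect (colour_weight p) (fun w => cnt w ^+ 2) =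
      \sum_u \sum_v cprob p (fun w => few (star u) w && few (star v) w).
    transitivity (expect (colour_weight p) (fun w => \sum_u \sum_v
        (few (star u) w && few (star v) w)%:R : R)).
      apply: eq_bigr => w _; congr (_ * _); rewrite /cnt expr2 big_distrl /=.
      apply: eq_bigr => u _; rewrite big_distrr /=; apply: eq_bigr => v _.
      by rewrite -natrM mulnb.
    by rewrite expect_sum; apply: eq_bigr => u _; rewrite expect_sum.
  apply: le_trans (ler_sum _ (fun u _ => ler_sum _ (fun v _ => pair u v))) _.
  under eq_bigr do rewrite big_split /= -mulr_suml -mulr_sumr.
  rewrite big_split /= -!mulr_suml -muE lerD ?lexx // le_eqVlt; apply/orP; left; apply/eqP.
  rewrite muE; apply: eq_bigr => u _.
  by rewrite (bigD1 u) //= eqxx big1 ?addr0 // => v vu; rewrite eq_sym (negPf vu).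
have E1 : expect (colour_weight p) cnt = mu.
  by rewrite /cnt expect_sum.
(* When no vertex is counted, (cnt - mu)^2 equals mu^2; hence mu^2 times the indicator is at most
   (cnt - mu)^2. *)
have main : mu ^+ 2 * cprob p (fun w => [forall v, (m < degree (coloured w) v)%N]) <=
    mu + mu ^+ 2 * (1 - p) ^- 2 - mu ^+ 2.
  rewrite -expectZ.
  apply: le_trans (_ : expect (colour_weight p)
      (fun w : {ffun edge n -> option bool} => cnt w ^+ 2 + ((- 2 * mu) * cnt w + mu ^+ 2 * 1)) <= _).
    apply: (le_expect cw0) => w.
    have sq : 0 <= (cnt w - mu) ^+ 2 by apply: sqr_ge0.
    case: forallP => [lo|_]; last by rewrite mulr0; move: sq; nra.
    have -> : cnt w = 0.
      by rewrite /cnt big1 // => v _; rewrite few_starE leqNgt lo.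
    by rewrite expr0n mulr0 !add0r.
  rewrite !expectD !expectZ E1 (expect1 _ (colour_weight_sum p)).
  by move: E2; nra.
rewrite -(ler_pM2l (x := mu ^+ 2)) ?exprn_gt0 //.
apply: le_trans main _; rewrite mulrDr mulrBr mulr1 expr2 mulfK ?gt_eqF //.
by rewrite -addrA.
Qed.

End SecondMoment.

(** Factor by factor, N(m - i) <= m(N - i). *)
Lemma expn_le_bin N m : (m <= N)%N -> (N ^ m <= 'C(N, m) * m ^ m)%N.
Proof.
move=> mN; rewrite -(leq_pmul2r (fact_gt0 m)) mulnAC bin_ffact -ffactnn !ffact_prod.
have prodE x : (x ^ m = \prod_(i < m) x)%N by rewrite prod_nat_const card_ord.
rewrite (prodE N) (prodE m) -!big_split /=.
apply: leq_prod => i _; rewrite mulnBr mulnBl leq_sub2l //.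
by rewrite mulnC leq_mul2r mN orbT.
Qed.

Section LowVertex.
Variables (R : realType) (n : nat) (p L : R) (m : nat).
Hypotheses (nE : n%:R = expR L) (L4 : 4 <= L) (p0 : 0 < p) (p1 : p <= 1 / 100).
Hypotheses (np_ge : L <= n%:R * p) (np_le : n%:R * p <= 102 / 100 * L).
Hypotheses (m_le : m%:R <= L / 200) (m_ge : L / 200 <= m%:R + 1) (Lp : L * p <= 1).

(** The mean is at least n (np'/m)^m e^(-1.02L - 3) with np' = (n - 1)p >= 150m, and 150 >= e^4.5.
    As m > L/200 - 1 or equal to it, the exponent is at least L(1 + 4.5/200 - 1.02) - 7.5 = L/400 -
    7.5. *)
Lemma prob_low_vertex :
  cprob p (fun w : {ffun edge n -> option bool} => [forall v, (m < degree (coloured w) v)%N]) <=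
  expR (8 - L / 400) + 3 * p.
Proof.
have [hL4 hnp hnp' hm] := And4 L4 np_ge np_le m_le.
have [hp0 hp1 hm' hLp] := And4 p0 p1 m_ge Lp.
have p01 : 0 <= p <= 1 by apply/andP; split; lra.
have p11 : p < 1 by lra.
have q1 : 0 < 1 - p by lra.
have n0 : 0 < n%:R :> R by rewrite nE expR_gt0.
have n0' : (0 < n)%N by rewrite -(ltr0n R).
have nL : 1 + L <= n%:R by rewrite nE expR_ge1Dx.
have n1E : n.-1%:R = n%:R - 1 :> R by rewrite -[in RHS](prednK n0') -natr1 addrK.
have mn : (m <= n.-1)%N by rewrite -(ler_nat R) n1E; lra.
pose mu : R := \sum_(v < n) cprob p (few m [set e : edge n | v \in val e]).
have e45 : expR (9 / 2 : R) <= 150.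
  rewrite -(ler_pXn2r (n := 2)) ?nnegrE ?expR_ge0 // -expRM_natr.
  rewrite (_ : 9 / 2 * 2 = 1 * 9%:R) ?expRM_natr; last by lra.
  apply: le_trans (_ : 3 ^+ 9 <= _); first by rewrite lerXn2r ?nnegrE ?expR_ge0 ?expR1_le.
  by lra.
have binm : 150 ^+ m <= 'C(n.-1, m)%:R * p ^+ m :> R.
  have [->|m0] := posnP m; first by rewrite bin0 !expr0 mulr1.
  have m0R : 0 < m%:R :> R by rewrite ltr0n.
  have := expn_le_bin mn; rewrite -(ler_nat R) natrM !natrX => hb.
  have h150 : 150 * m%:R <= n.-1%:R * p by rewrite n1E mulrBl mul1r; lra.
  rewrite -(ler_pM2r (x := m%:R ^+ m)) ?exprn_gt0 // -exprMn mulrAC.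
  apply: le_trans (_ : (n.-1%:R * p) ^+ m <= _).
    by rewrite lerXn2r ?nnegrE ?mulr_ge0 ?(ltW p0).
  by rewrite exprMn ler_wpM2r ?exprn_ge0 ?(ltW p0).
(* The constant 3 absorbs the quadratic correction 2np^2, which is at most 2.04 by [Lp]. *)
have qn : expR (- (102 / 100 * L) - 3) <= (1 - p) ^+ n.-1.
  have h1 : (1 - p)^-1 <= expR (p + 2 * p ^+ 2).
    apply: le_trans (expR_ge1Dx _); rewrite -[leLHS]mul1r ler_pdivrMr //; nra.
  have h2 : expR (- (p + 2 * p ^+ 2)) <= 1 - p.
    by rewrite expRN -[leRHS]invrK lef_pV2 ?posrE ?expR_gt0 ?invr_gt0.
  apply: le_trans (_ : (1 - p) ^+ n <= _); last first.
    apply: ler_wiXn2l (leq_pred _); [exact: ltW | lra].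
  apply: le_trans (lerXn2r n _ _ h2); rewrite ?nnegrE ?expR_ge0 ?(ltW q1) //.
  rewrite -expRM_natr ler_expR mulNr -opprD lerN2.
  have -> : (p + 2 * p ^+ 2) * n%:R = n%:R * p + 2 * (n%:R * p) * p by ring.
  have : n%:R * p * p <= 102 / 100 * L * p by rewrite ler_wpM2r // ltW.
  by lra.
have mu_ge : expR (L / 400 - 8) <= mu.
  apply: le_trans (_ : n%:R * (150 ^+ m * expR (- (102 / 100 * L) - 3)) <= _).
    have h : expR (9 / 2 * (L / 200 - 1)) <= 150 ^+ m.
      apply: le_trans (_ : expR (9 / 2) ^+ m <= _); last first.
        by rewrite lerXn2r ?nnegrE ?expR_ge0.
      by rewrite -expRM_natr ler_expR; apply: ler_wpM2l; lra.
    apply: le_trans (_ : expR L * (expR (9 / 2 * (L / 200 - 1)) * expR (- (102 / 100 * L) - 3)) <= _).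
      by rewrite -!expRD ler_expR; lra.
    by rewrite nE ler_wpM2l ?expR_ge0 // ler_wpM2r ?expR_ge0.
  rewrite /mu -[n in leLHS]card_ord mulr_natl -sumr_const; apply: ler_sum => v _.
  have := @prob_few_ge R n p m p01 [set e : edge n | v \in val e].
  rewrite card_star => /(_ mn); apply: le_trans.
  by apply: ler_pM; rewrite ?exprn_ge0 ?expR_ge0.
have mu0 : 0 < mu by apply: lt_le_trans mu_ge; rewrite expR_gt0.
apply: le_trans (prob_no_low_vertex p01 p11 mu0) _; apply: lerD.
  rewrite (_ : 8 - L / 400 = - (L / 400 - 8)); last by lra.
  by rewrite expRN lef_pV2 ?posrE ?expR_gt0.
rewrite lerBlDr -[leLHS]mul1r ler_pdivrMr ?exprn_gt0 //; nra.
Qed.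

End LowVertex.

(** * Asymptotics *)

Section Resilience.
Variables (R : realType) (n : nat) (p L : R) (m s0 : nat).
Implicit Types (w : {ffun edge n -> option bool}).

Lemma atypicalP w : ~ typical m s0 (red w) (blue w) ->
  [|| [exists v, (degree (coloured w) v <= 1)%N],
      [forall v, (m < degree (coloured w) v)%N],
      has_low_dense m w, has_dense s0 w, has_sparse_cut m s0 w
    | has_few_boosters m w].
Proof.
move=> ntyp; apply: contraT; rewrite !negb_or => /and5P[e1 e2 e3 e4 /andP[e5 e6]].
case: ntyp; split.
- by move=> v; rewrite ltnNge; apply: contra e1 => dv; apply/existsP; exists v.
- by move: e2; rewrite negb_forall => /existsP[v]; rewrite -leqNgt; exists v.
- move=> W A AW A0 W5 AL; rewrite leqNgt; apply: contra e3 => H.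
  by apply/existsP; exists W; apply/existsP; exists A; apply/and5P.
- move=> W /andP[W0 Ws]; rewrite ltnNge; apply: contra e4 => H.
  by apply/existsP; exists W; apply/and3P.
- move=> S T Ss S5 T2; rewrite ltnNge; apply: contra e5 => H.
  by apply/existsP; exists S; apply/existsP; exists T; apply/and4P.
- move=> F1 F2 F1w F2w F2n nB; rewrite ltnNge; apply: contra e6 => H.
  by apply/existsP; exists F1; apply/existsP; exists F2; apply/and5P.
Qed.

Definition tight_resilience (G : graph n) :=
  (local_resilience (@hamiltonian n) G)%:Z == (min_degree G)%:Z - 1.

Hypotheses (nE : n%:R = expR L) (L4 : 4 <= L) (p0 : 0 < p) (p1 : p <= 1 / 100).
Hypotheses (np_ge : L <= n%:R * p) (np_le : n%:R * p <= 102 / 100 * L).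
Hypotheses (m_le : m%:R <= L / 200) (m_ge : L / 200 <= m%:R + 1) (Lp : L * p <= 1).
Hypotheses (m_low : (m + 20)%:R <= 6 / 1000 * L) (n25 : (25 <= n)%N).
Hypotheses (s0_le : s0%:R * L ^+ 4 <= n%:R) (s0_ge : n%:R <= s0.+1%:R * L ^+ 4).
Hypothesis rho2 : L ^+ 12 * expR (2 - L / 2000) <= 1 / 2.

Lemma Gnp_tight_ge : 1 - Gnp_prob p tight_resilience <=
  n%:R * (1 + n%:R * p) * expR (- (p * (n%:R - 2))) +
  (expR (8 - L / 400) + 3 * p +
  (32 * (2 * L) ^+ 5 * expR (16 - 22 / 100 * L) +
  (16 / L ^+ 2 +
  (2 * (L ^+ 12 * expR (2 - L / 2000)) +
   expR (n%:R * (1 + 21 * ln L - 14 / 10 / 1000 * L)))))).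
Proof.
have p01 : 0 <= p <= 1 by have [? ?] := (p0, p1); apply/andP; split; lra.
have cw0 := colour_weight_ge0 p01.
rewrite Gnp_prob_coloured -(probC (colour_weight_sum p)).
pose bad w := [|| [exists v, (degree (coloured w) v <= 1)%N],
      [forall v, (m < degree (coloured w) v)%N],
      has_low_dense m w, has_dense s0 w, has_sparse_cut m s0 w
    | has_few_boosters m w].
apply: le_trans (_ : cprob p bad <= _).
  apply: (le_prob cw0) => w /= nt; apply: atypicalP => typ.
  move: nt => /negP; apply; rewrite /tight_resilience -(typical_resilience n25 typ).
  by rewrite -addn1 PoszD addrK.
apply: le_trans (prob_orb cw0 _ _) _; apply: lerD.
  by apply: prob_low_degree => //; exact: leq_trans n25.
apply: le_trans (prob_orb cw0 _ _) _; apply: lerD; first exact: prob_low_vertex.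
apply: le_trans (prob_orb cw0 _ _) _; apply: lerD; first exact: prob_has_low_dense.
apply: le_trans (prob_orb cw0 _ _) _; apply: lerD; first exact: (prob_has_dense nE L4 p0 p1 np_ge np_le m_le s0_le).
apply: le_trans (prob_orb cw0 _ _) _; apply: lerD; first exact: prob_has_sparse_cut.
exact: prob_has_few_boosters.
Qed.

Lemma Gnp_tight_le1 : Gnp_prob p tight_resilience <= 1.
Proof.
have p01 : 0 <= p <= 1 by have [? ?] := (p0, p1); apply/andP; split; lra.
rewrite Gnp_prob_coloured -subr_ge0 -(probC (colour_weight_sum p)).
exact: prob_ge0 (colour_weight_ge0 p01) _.
Qed.

End Resilience.

(** * Asymptotics of the error terms *)

Section Limits.
Variable R : realType.
Implicit Types (x c eps : R).

(** The term of degree k + 1 of the series of e^(cx) is at least x^k/eps as soon as x >= d. *)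
Lemma poly_expR_small k c eps : 0 < c -> 0 < eps ->
  exists2 C : R, 1 <= C & forall x, C <= x -> x ^+ k * expR (- (c * x)) <= eps.
Proof.
move=> c0 eps0.
pose d : R := k.+1`!%:R / (c ^+ k.+1 * eps).
exists (1 + d).
  by rewrite lerDl divr_ge0 // mulr_ge0 ?exprn_ge0 ?ltW.
move=> x Cx.
have x1 : 1 + d <= x by [].
have d0 : 0 <= d by rewrite divr_ge0 // mulr_ge0 ?exprn_ge0 ?ltW.
have x0 : 0 < x by lra.
have cx : 0 <= c * x by rewrite mulr_ge0 ?ltW.
have E : (c * x) ^+ k.+1 / k.+1`!%:R <= expR (c * x).
  by apply: le_trans (expR_ge1Dxn k cx); rewrite lerDr ler01.
rewrite expRN ler_pdivrMr ?expR_gt0 //.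
apply: le_trans (ler_wpM2l (ltW eps0) E).
rewrite mulrA ler_pdivlMr ?ltr0n ?fact_gt0 // exprMn.
rewrite [x ^+ k.+1]exprSr (_ : eps * _ = x ^+ k * (c ^+ k.+1 * eps * x)); last by ring.
rewrite ler_wpM2l ?exprn_ge0 ?(ltW x0) // -ler_pdivrMl ?mulr_gt0 ?exprn_gt0 //.
rewrite mulrC -/d; lra.
Qed.

(** Used with x = ln n, so that one threshold serves all admissible n, p and w at once. *)
Definition for_large (P : R -> Prop) := exists C : R, forall x, C <= x -> P x.

Lemma for_large_and (P Q : R -> Prop) :
  for_large P -> for_large Q -> for_large (fun x => P x /\ Q x).
Proof.
move=> [C HC] [D HD]; exists (Num.max C D) => x; rewrite ge_max => /andP[? ?].
by split; [apply: HC | apply: HD].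
Qed.

Lemma for_large_ge c : for_large (fun x => c <= x).
Proof. by exists c. Qed.

Lemma for_large_sub (P Q : R -> Prop) :
  for_large P -> (forall x, P x -> Q x) -> for_large Q.
Proof. by move=> [C HC] PQ; exists C => x /HC/PQ. Qed.

Lemma for_large_expR k c a b eps : 0 < a -> 0 < c -> 0 < eps ->
  for_large (fun x => a * (x ^+ k * expR (b - c * x)) <= eps).
Proof.
move=> a0 c0 eps0; have ab : 0 < a * expR b by rewrite mulr_gt0 ?expR_gt0.
have [C _ HC] := poly_expR_small k c0 (divr_gt0 eps0 ab).
exists C => x /HC; rewrite ler_pdivlMr // expRD => h.
by rewrite (_ : a * _ = x ^+ k * expR (- (c * x)) * (a * expR b)) //; ring.
Qed.

Lemma for_large_ln : for_large (fun x => 1 + 21 * ln x - 14 / 10 / 1000 * x <= - 1).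
Proof.
(* 21/30000 is half of 14/10000, so ln x <= x/30000 leaves half of the linear term to absorb the
   constants. *)
have c0 : 0 < 1 / 30 / 1000 :> R by lra.
have [C C1 HC] := poly_expR_small 1 c0 ltr01.
have h2 := for_large_and (for_large_ge 1) (for_large_ge (2 / (21 * (1 / 30 / 1000)))).
apply: for_large_sub (for_large_and (ex_intro _ C HC) h2) _.
move=> x [h [x1 x2]]; have x0 : 0 < x by lra.
have h9 : ln x <= 1 / 30 / 1000 * x.
  rewrite -[leRHS]expRK ler_ln ?posrE ?expR_gt0 // -[leRHS]mul1r -ler_pdivrMr ?expR_gt0 // -expRN.
  by rewrite expr1 in h.
by lra.
Qed.

Lemma for_large_inv_sqr eps : 0 < eps -> for_large (fun x => 16 / x ^+ 2 <= eps).
Proof.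
move=> eps0; apply: for_large_sub (for_large_and (for_large_ge 1) (for_large_ge (16 / eps))) _.
move=> x [x1 x2]; have x0 : 0 < x by lra.
have h : 16 <= eps * x by rewrite mulrC -ler_pdivrMr.
rewrite ler_pdivrMr ?exprn_gt0 // expr2 mulrA; apply: le_trans h _.
by rewrite ler_peMr // mulr_ge0 ?ltW.
Qed.

(** The summand ln ln n of the lower bound on np cancels the factor 1 + np = O(L), the summand ln n
    cancels n, and only e^(-w) remains. This is the one error term that needs [w] to tend to
    infinity. *)
Lemma min_degree_error (N p L w : R) : N = expR L -> 4 <= L -> 0 < p -> p <= 1 / 100 ->
  L + ln L + w <= N * p -> N * p <= 102 / 100 * L ->
  N * (1 + N * p) * expR (- (p * (N - 2))) <= 6 * expR (- w).
Proof.
move=> NE L4 p0 p1 np_lo np_le; have L0 : 0 < L by lra.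
have N0 : 0 < N by rewrite NE expR_gt0.
have np0 : 0 <= N * p by rewrite mulr_ge0 ?ltW.
apply: le_trans (_ : N * (2 * L) * (expR (- L) * (L^-1 * (expR (- w) * 3))) <= _).
  apply: ler_pM; rewrite ?expR_ge0 //.
  - by apply: mulr_ge0; [exact: ltW | lra].
  - by apply: ler_wpM2l; [exact: ltW | lra].
  - have -> : L^-1 = expR (- ln L) by rewrite expRN lnK ?posrE.
    apply: le_trans (_ : expR (- L) * (expR (- ln L) * (expR (- w) * expR 1)) <= _).
      by rewrite -!expRD ler_expR; move: np_lo; rewrite mulrBr [p * N]mulrC; lra.
    by rewrite !ler_wpM2l ?expR_ge0 ?expR1_le.
have -> : N * (2 * L) * (expR (- L) * (L^-1 * (expR (- w) * 3))) =
    (N * expR (- L)) * (L / L) * (6 * expR (- w)) by ring.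
by rewrite NE -expRD subrr expR0 divff ?gt_eqF // !mul1r.
Qed.

Lemma resilience_whp eps : 0 < eps ->
  exists C : R, forall (n : nat) (p w : R), C <= ln n%:R -> C <= w ->
  (ln n%:R + ln (ln n%:R) + w) / n%:R <= p <= 102 / 100 * ln n%:R / n%:R ->
  1 - eps <= Gnp_prob p (@tight_resilience n) <= 1.
Proof.
move=> eps0.
(* Six failures but seven shares: the bound for a missing vertex of low degree has two terms. *)
have [d epsE d0] : exists2 d, eps = d + (d + d + (d + (d + (d + d)))) & 0 < d.
  by exists (eps / 7); [lra | rewrite divr_gt0].
have [a1 a2 a32] : [/\ 0 < 1 :> R, 0 < 2 :> R & 0 < 32 * 2 ^+ 5 :> R] by split; lra.
have [c1 c2 c3] : [/\ 0 < 1 / 400 :> R, 0 < 22 / 100 :> R & 0 < 1 / 2000 :> R] by split; lra.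
have d6 : 0 < d / 6 by rewrite divr_gt0.
have d4 : 0 < d / 4 by rewrite divr_gt0.
have [b1 b2] : 0 < 1 / 200 :> R /\ 0 < 1 / 2 :> R by split; lra.
have [C HC] := for_large_and (for_large_expR 0 0 a1 a1 d6)
  (for_large_and (for_large_expR 0 8 a1 c1 d0)
  (for_large_and (for_large_expR 1 0 a1 a1 d4)
  (for_large_and (for_large_expR 1 0 a1 a1 b1)
  (for_large_and (for_large_expR 2 0 a1 a1 b2)
  (for_large_and (for_large_expR 5 16 a32 c2 d0)
  (for_large_and (for_large_expR 12 2 a2 c3 d0)
  (for_large_and (for_large_expR 12 2 a1 c3 b2)
  (for_large_and for_large_ln
  (for_large_and (for_large_inv_sqr d0)
  (for_large_and (for_large_ge 25) (for_large_ge (20 * 1000)))))))))))).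
exists C => n p w; have [L LE] : exists L : R, L = ln n%:R by exists (ln n%:R).
rewrite -!LE => /HC.
(* The same threshold is applied to [L] and to [w]; for [w] only e^(-w) <= d/6 and w >= 25 are
   kept. *)
move=> [f1 [f2 [f3 [f4 [f5 [f6 [f7 [f8 [f9 [f10 [f11 f12]]]]]]]]]]] /HC[h1 [_ [_ [_ [_ [_ [_ [_ [_ [_ [w25 _]]]]]]]]]]].
rewrite ?(mul1r, expr0, expr1, add0r) in f1 f2 f3 f4 f5 f7 f8 h1.
rewrite [_^-1 * L]mulrC in f2; rewrite [_^-1 * L]mulrC in f7; rewrite [_^-1 * L]mulrC -[leRHS]mul1r in f8.
move=> {a1 a2 a32 c1 c2 c3 b1 b2 d6 d4 HC}.
have m_low m : m%:R <= L / 200 -> (m + 20)%:R <= 6 / 1000 * L by rewrite natrD; lra.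
have {}f6 : 32 * (2 * L) ^+ 5 * expR (16 - 22 / 100 * L) <= d by rewrite exprMn -!mulrA mulrA in f6 *.
move: (And5 f2 f6 f7 f8 f9) => F {f2 f6 f7 f8 f9 f12}.
move=> /andP[p_lo p_hi].
have L4 : 4 <= L by lra.
have L1 : 1 <= L by lra.
have L0 : 0 < L by lra.
have n0 : 0 < n%:R :> R.
  rewrite ltr0n lt0n; apply/eqP => n0.
  by move: L0; rewrite LE n0 ln0 // ltxx.
have nE : n%:R = expR L by rewrite LE lnK // posrE.
have lnL : 0 <= ln L by exact: ln_ge0.
have np_le : n%:R * p <= 102 / 100 * L by move: p_hi; rewrite ler_pdivlMr // mulrC.
have np_lo : L + ln L + w <= n%:R * p by move: p_lo; rewrite ler_pdivrMr // [p * _]mulrC.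
have np_ge : L <= n%:R * p by lra.
have p0 : 0 < p by rewrite -(pmulr_rgt0 _ n0) (lt_le_trans L0).
have nV : n%:R^-1 = expR (- L) by rewrite nE expRN.
have p_le : p <= 102 / 100 * (L * expR (- L)) by rewrite -nV mulrA.
have p1 : p <= 1 / 100 by lra.
have Lp : L * p <= 1.
  apply: le_trans (ler_wpM2l (ltW L0) p_le) _.
  have -> : L * (102 / 100 * (L * expR (- L))) = 102 / 100 * (L ^+ 2 * expR (- L)) by ring.
  by move: f5; move: (L ^+ 2 * _) => x; lra.
have Ln : 1 + L <= n%:R by rewrite nE expR_ge1Dx.
have n25 : (25 <= n)%N by rewrite -(ler_nat R); lra.
(* [m] and, below, [s0] are the integer parts of L/200 and n/L^4. *)
have [m m_le m_ge] : exists2 m, m%:R <= L / 200 & L / 200 <= m%:R + 1.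
  have /andP[h h'] := truncn_itv (divr_ge0 (ltW L0) (ler0n R 200)).
  by exists (Num.truncn (L / 200)) => //; rewrite natr1 ltW.
have L4n : 0 <= n%:R / L ^+ 4 by rewrite divr_ge0 ?exprn_ge0 // ltW.
have [s0 s0_le s0_ge] : exists2 s0, s0%:R * L ^+ 4 <= n%:R & n%:R <= s0.+1%:R * L ^+ 4.
  have /andP[h h'] := truncn_itv L4n.
  exists (Num.truncn (n%:R / L ^+ 4)); first by rewrite -ler_pdivlMr ?exprn_gt0.
  by rewrite -ler_pdivrMr ?exprn_gt0 // ltW.
have w6 : 6 * expR (- w) <= d by lra.
have t2' : 3 * p <= d by lra.
have dL : expR (- L) <= d by lra.
move=> {f1 f3 f4 f5 h1}; case: F => f2 f6 f7 f8 f9.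
apply/andP; split; last by exact: Gnp_tight_le1.
have main := Gnp_tight_ge nE L4 p0 p1 np_ge np_le m_le m_ge Lp (m_low _ m_le) n25 s0_le s0_ge f8.
rewrite lerBlDl -lerBlDr; apply: le_trans main _.
have t1 : n%:R * (1 + n%:R * p) * expR (- (p * (n%:R - 2))) <= d.
  exact: le_trans (min_degree_error nE L4 p0 p1 np_lo np_le) w6.
have t6 : expR (n%:R * (1 + 21 * ln L - 14 / 10 / 1000 * L)) <= d.
  apply: le_trans dL; rewrite ler_expR; apply: le_trans (ler_wpM2l (ltW n0) f9) _.
  by rewrite mulrN1 lerN2; apply: le_trans Ln; rewrite lerDr.
by rewrite epsE !lerD.
Qed.

End Limits.

From HB Require Import structures.
From mathcomp Require Import all_classical all_reals all_analysis.
Import numFieldNormedType.Exports.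
Local Open Scope classical_set_scope.

Theorem theorem2 (R : realType) (p w : nat -> R)
    (w_infty : w n @[n --> \oo] --> +oo)
    (p_bounds : \forall n \near \oo,
       (ln n%:R + ln (ln n%:R) + w n) / n%:R <= p n
         <= 102 / 100 * ln n%:R / n%:R) :
  Gnp_prob (p n)
    (fun G : graph n =>
       (local_resilience (@hamiltonian n) G)%:Z == (min_degree G)%:Z - 1)
    @[n --> \oo] --> (1 : R).
Proof.
apply/cvgrPdist_le => eps eps0; have [C HC] := resilience_whp eps0.
near=> n.
have wC : C <= w n by near: n; move/cvgryPge: w_infty; apply.
have LC : C <= ln n%:R.
  have nC : expR C <= n%:R by near: n; exact: nbhs_infty_ger.
  by rewrite -[leLHS]expRK ler_ln ?posrE ?expR_gt0 // (lt_le_trans (expR_gt0 C)).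
have pn : (ln n%:R + ln (ln n%:R) + w n) / n%:R <= p n <= 102 / 100 * ln n%:R / n%:R.
  by near: n.
have /andP[lo hi] := HC _ _ _ LC wC pn.
by rewrite ger0_norm ?subr_ge0 // lerBlDl -lerBlDr.
Unshelve. all: by end_near.
Qed.
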